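(* Consider the system $\dot{\boldsymbol{x}}=f(\boldsymbol{x})+g(\boldsymbol{x})\boldsymbol{u}+\boldsymbol{w}$ with state $\boldsymbol{x}\in\mathbb{R}^n$, initial condition $\boldsymbol{x}(0)=\boldsymbol{x}_0$, input $\boldsymbol{u}\in\mathbb{R}^m$ and additive noise $\boldsymbol{w}\in\mathcal{W}$, where $\mathcal{W}\subset\mathbb{R}^n$ is a bounded set, and let $\phi=G_{[a,b]}\psi$ or $\phi=F_{[a,b]}\psi$ with $\psi$ a non-temporal formula. Assume: (A1) $f:\mathbb{R}^n\to\mathbb{R}^n$ and $g:\mathbb{R}^n\to\mathbb{R}^{n\times m}$ are locally Lipschitz continuous, and $g(\boldsymbol{x})g^T(\boldsymbol{x})$ is positive definite for all $\boldsymbol{x}\in\mathbb{R}^n$; (A2) in the robustness $\rho^\psi$, the non-smooth conjunction $\min(\rho^{\psi_1},\rho^{\psi_2})$ is approximated by the smooth function $-\ln\big(\exp(-\rho^{\psi_1})+\exp(-\rho^{\psi_2})\big)$; (A3) $\psi$ is such that 1) $\rho^\psi(\boldsymbol{x})$ is concave and 2) $\psi$ is well-posed in the sense that $(\boldsymbol{x},0)\models\psi$ implies $\|\boldsymbol{x}(0)\|<\infty$; (A4) $\rho^\psi_{opt}:=\sup_{\boldsymbol{x}\in\mathbb{R}^n}\rho^\psi(\boldsymbol{x})>0$. Let $\rho_{max}\in\big(\max(0,\rho^\psi(\boldsymbol{x}_0)),\rho^\psi_{opt}\big)$ and $r\in[0,\rho_{max})$. Let $t_*\in\mathbb{R}_{\ge0}$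 with $t_*=a$ if $\phi=G_{[a,b]}\psi$ and $t_*\in[a,b]$ if $\phi=F_{[a,b]}\psi$. Assume that $\phi$ is feasible with respect to $r$, $\boldsymbol{x}_0$ and $t_*$, i.e. either $t_*>0$, or $t_*=0$ and $\rho^\psi(\boldsymbol{x}_0)>r$. Suppose the control law $$\boldsymbol{u}(\boldsymbol{x},t)=-\epsilon(\boldsymbol{x},t)\,g^T(\boldsymbol{x})\,\frac{\partial\rho^\psi(\boldsymbol{x})}{\partial\boldsymbol{x}}$$ is used, where $\epsilon(\boldsymbol{x},t)=\ln\big(-\frac{\xi(\boldsymbol{x},t)+1}{\xi(\boldsymbol{x},t)}\big)$, $\xi(\boldsymbol{x},t)=\frac{\rho^\psi(\boldsymbol{x})-\rho_{max}}{\gamma(t)}$ and $\gamma(t)=(\gamma_0-\gamma_\infty)\exp(-lt)+\gamma_\infty$. Then choosing $$\gamma_0\in\begin{cases}(\rho_{max}-\rho^\psi(\boldsymbol{x}_0),\infty)&\text{if }t_*>0\\(\rho_{max}-\rho^\psi(\boldsymbol{x}_0),\rho_{max}-r]&\text{if }t_*=0,\end{cases}\qquad \gamma_\infty\in\big(0,\min(\gamma_0,\rho_{max}-r)\big],$$ and $$l\in\mathbb{R}_{\ge0}\ \text{ if } -\gamma_0+\rho_{max}\ge r,\qquad l=-\frac{1}{t_*}\ln\Big(\frac{r+\gamma_\infty-\rho_{max}}{-(\gamma_0-\gamma_\infty)}\Big)\ \text{ if } -\gamma_0+\rho_{max}<r \text{ and } t_*>0,$$ ensures that $0\le r<\rho^\phi(\boldsymbol{x},0)<\rho_{max}$,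 i.e., $(\boldsymbol{x},0)\models\phi$, for the closed-loop solution $\boldsymbol{x}:\mathbb{R}_{\ge0}\to\mathbb{R}^n$.
   Context: A predicate $\mu$ is given by a function $h:\mathbb{R}^n\to\mathbb{R}$; it is true at $\boldsymbol{x}\in\mathbb{R}^n$ iff $h(\boldsymbol{x})\ge0$. Non-temporal formulas are generated by $\psi::=\top\mid\mu\mid\neg\mu\mid\psi_1\wedge\psi_2$. For a signal $\boldsymbol{x}:\mathbb{R}_{\ge0}\to\mathbb{R}^n$, $(\boldsymbol{x},t)\models\psi$ means $\psi$ is true at $\boldsymbol{x}(t)$; $(\boldsymbol{x},t)\models F_{[a,b]}\psi$ iff there is $t_1\in[t+a,t+b]$ with $(\boldsymbol{x},t_1)\models\psi$; $(\boldsymbol{x},t)\models G_{[a,b]}\psi$ iff $(\boldsymbol{x},t_1)\models\psi$ for all $t_1\in[t+a,t+b]$. Here $a,b\in\mathbb{R}_{\ge0}\cup\{\infty\}$ with $a\le b$. Robustness, with the approximation of (A2): $\rho^\mu(\boldsymbol{x}):=h(\boldsymbol{x})$, $\rho^{\neg\mu}(\boldsymbol{x}):=-h(\boldsymbol{x})$, and $\rho^{\psi_1\wedge\psi_2}(\boldsymbol{x}):=-\ln\big(\exp(-\rho^{\psi_1}(\boldsymbol{x}))+\exp(-\rho^{\psi_2}(\boldsymbol{x}))\big)$; by convention $\rho^\top=+\infty$. For signals, $\rho^{F_{[a,b]}\psi}(\boldsymbol{x},t):=\max_{t_1\in[t+a,t+b]}\rho^\psi(\boldsymbol{x}(t_1))$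 and $\rho^{G_{[a,b]}\psi}(\boldsymbol{x},t):=\min_{t_1\in[t+a,t+b]}\rho^\psi(\boldsymbol{x}(t_1))$. The gradient $\partial\rho^\psi/\partial\boldsymbol{x}$ is a column vector.
   Formalization: Well-posedness (A3.2), vacuous as written, is read as: the set of states satisfying ψ is bounded (else finite escape can occur); and when l is given by the logarithm its argument must be positive, excluding γ_∞ = ρ_max − r < γ_0, where l is undefined. *)

(* Defs.v *)
From HB Require Import structures.
From mathcomp Require Import all_boot all_order all_algebra.
From mathcomp Require Import all_classical all_reals all_analysis.

Set Implicit Arguments.
Unset Strict Implicit.
Unset Printing Implicit Defensive.

Import Order.TTheory GRing.Theory Num.Theory.
Import numFieldNormedType.Exports.

Local Open Scope classical_set_scope.
Local Open Scope ring_scope.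

(* Column vectors carry the sup norm; boundedness and local
   Lipschitz continuity do not depend on the choice of norm on R^n. Signals are
   functions on R, of which only the values at nonnegative times matter. *)

Section stl.
Context {R : realType} {n : nat}.
Implicit Types (v : 'cV[R]_n) (x : R -> 'cV[R]_n) (t : R).

(* A predicate is represented by the function whose nonnegativity defines its
   truth value. Negation applies to predicates only. *)
Inductive formula :=
| Top
| Pred of ('cV[R]_n -> R)
| NegPred of ('cV[R]_n -> R)
| And of formula & formula.

Fixpoint holds (psi : formula) v : Prop :=
  match psi with
  | Top => True
  | Pred h => 0 <= h v
  | NegPred h => ~ (0 <= h v)
  | And psi1 psi2 => holds psi1 v /\ holds psi2 v
  end.

Definition sat0 x t (psi : formula) : Prop := holds psi (x t).

(* The minimum in conjunctions is replaced by its smooth under-approximation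
   -ln(exp(-a) + exp(-b)). Extended-real valued because the robustness of Top is
   +oo; as expeR -oo = 0 and lne 0 = -oo, conjunction needs no special case. *)
Fixpoint robust (psi : formula) v : \bar R :=
  match psi with
  | Top => +oo
  | Pred h => (h v)%:E
  | NegPred h => (- h v)%:E
  | And psi1 psi2 =>
      - lne (expeR (- robust psi1 v) + expeR (- robust psi2 v))
  end%E.

(* Real-valued robustness; no information is lost except where it is +oo. *)
Definition robustR (psi : formula) v : R := fine (robust psi v).

Definition robust_opt (psi : formula) : \bar R :=
  ereal_sup (range (robust psi)).

Definition concave_robust (psi : formula) : Prop :=
  forall v1 v2 (k : R), 0 <= k <= 1 ->
    (k%:E * robust psi v1 + (1 - k)%:E * robust psi v2
       <= robust psi (k *: v1 + (1 - k) *: v2))%E.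

(* The finite bound on the norm is uniform in the satisfying signal: a bound
   depending on it would exist for every formula. *)
Definition well_posed (psi : formula) : Prop :=
  exists C : R, forall x, sat0 x 0 psi -> `|x 0| <= C.

Definition gradient (F : 'cV[R]_n -> R) v : 'cV[R]_n :=
  \col_i 'D_(delta_mx i 0) F v.

Inductive temporal :=
| Always of \bar R & \bar R & formula
| Eventually of \bar R & \bar R & formula.

Definition window t (a b : \bar R) : set R :=
  [set s | (t%:E + a <= s%:E)%E /\ (s%:E <= t%:E + b)%E].

Definition sat x t (phi : temporal) : Prop :=
  match phi with
  | Always a b psi => forall s, window t a b s -> sat0 x s psi
  | Eventually a b psi => exists2 s, window t a b s & sat0 x s psi
  end.

(* Extrema are taken in the extended reals, so that they are also meaningful
   on unbounded windows, where a maximum or minimum need not be attained. *)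
Definition robust_temporal (phi : temporal) x t : \bar R :=
  match phi with
  | Always a b psi => ereal_inf [set robust psi (x s) | s in window t a b]
  | Eventually a b psi => ereal_sup [set robust psi (x s) | s in window t a b]
  end.

(* For a real ts, the first clause forces the left endpoint to be finite. *)
Definition admissible_time (phi : temporal) (ts : R) : Prop :=
  match phi with
  | Always a b _ => ts%:E = a
  | Eventually a b _ => (a <= ts%:E)%E /\ (ts%:E <= b)%E
  end.

Definition feasible (psi : formula) (r : R) (x0 : 'cV[R]_n) (ts : R) : Prop :=
  0 < ts \/ (ts = 0 /\ (r%:E < robust psi x0)%E).

End stl.

Arguments formula : clear implicits.
Arguments temporal : clear implicits.

Definition posdef {R : realType} {n : nat} (A : 'M[R]_n) : Prop :=
  A^T = A /\ forall v : 'cV[R]_n, v != 0 -> 0 < (v^T *m A *m v) 0 0.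

Section control.
Context {R : realType} {n m : nat}.
Variables (psi : formula R n) (rho_max : R).

Definition funnel (gamma0 gamma_inf l t : R) : R :=
  (gamma0 - gamma_inf) * expR (- l * t) + gamma_inf.

Variable gamma : R -> R.

Definition xi (v : 'cV[R]_n) (t : R) : R :=
  (robustR psi v - rho_max) / gamma t.

(* Meaningful when -1 < xi v t < 0; elsewhere the value is an artefact of ln
   and division being total. *)
Definition epsilon (v : 'cV[R]_n) (t : R) : R :=
  ln (- ((xi v t + 1) / xi v t)).

Definition control (g : 'cV[R]_n -> 'M[R]_(n, m)) (v : 'cV[R]_n) (t : R)
    : 'cV[R]_m :=
  - epsilon v t *: ((g v)^T *m gradient (robustR psi) v).

Definition closed_loop (f : 'cV[R]_n -> 'cV[R]_n)
    (g : 'cV[R]_n -> 'M[R]_(n, m)) (w : R -> 'cV[R]_n)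
    (v : 'cV[R]_n) (t : R) : 'cV[R]_n :=
  f v + g v *m control g v t + w t.

End control.

(* Solution in the sense of Caratheodory of x' = F(x, t), x(0) = x0, on
   [0, +oo[: the noise is only measurable, hence the integral form. Continuity
   (even local absolute continuity) of x on [0, +oo[ follows. *)
Definition solution {R : realType} {n : nat}
    (F : 'cV[R]_n -> R -> 'cV[R]_n) (x0 : 'cV[R]_n) (x : R -> 'cV[R]_n) : Prop :=
  forall (t : R) (i : 'I_n), 0 <= t ->
    lebesgue_measure.-integrable `[0, t] (EFin \o (fun s => F (x s) s i 0)) /\
    x t i 0 = x0 i 0 + \int[lebesgue_measure]_(s in `[0, t]) F (x s) s i 0.

Definition noise {R : realType} {n : nat} (W : set 'cV[R]_n)
    (w : R -> 'cV[R]_n) : Prop :=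
  (forall t, 0 <= t -> W (w t)) /\
  (forall i : 'I_n, @measurable_fun _ _ R R `[0, +oo[ (fun t => w t i 0)).

(* Main.v *)
(* The trajectory is confined to a strictly smaller funnel -1 + d < xi < -d, with
   d independent of time. Well-posedness and concavity make the superlevel sets
   of the robustness compact; on the part of such a set where the robustness is
   at most rho_max, which is below the supremum, the gradient does not vanish, so
   the feedback dominates f, the noise and the speed of the funnel as soon as
   |epsilon| exceeds a uniform constant. The uniform d also gives the strict
   inequalities for the infimum and the supremum over unbounded windows.
   For existence, the feedback is truncated outside the smaller funnel, which
   leaves a bounded field that is continuous in the state (the gradient of a
   differentiable concave function is continuous, but need not be locally
   Lipschitz); subtracting the antiderivative of the noise reduces the problem to
   Peano's theorem, and confinement shows that the truncation is never active. *)

Require Import Defs.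
From mathcomp Require Import all_boot all_order all_algebra.
From mathcomp Require Import all_classical all_reals all_analysis.
From mathcomp Require Import ring lra.

Set Implicit Arguments.
Unset Strict Implicit.
Unset Printing Implicit Defensive.

Import Order.TTheory GRing.Theory Num.Theory.
Import numFieldNormedType.Exports.

Local Open Scope classical_set_scope.
Local Open Scope ring_scope.

(** * Convergence and compactness of matrices *)

Lemma coord_norm_le (R : realType) (m n : nat) (A : 'M[R]_(m, n)) i j :
  `|A i j| <= `|A|.
Proof.
by rewrite [leRHS]/Num.norm /= mx_normrE; apply/bigmax_geP; right; exists (i, j).
Qed.

Lemma mx_norm_le (R : realType) (m n : nat) (A : 'M[R]_(m, n)) (e : R) :
  0 <= e -> (forall i j, `|A i j| <= e) -> `|A| <= e.
Proof.
move=> e0 Ae; rewrite [leLHS]/Num.norm /= mx_normrE.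
by apply/bigmax_leP; split=> // -[i j] _; exact: Ae.
Qed.

Lemma cvg_coord (R : realType) (m n : nat) (T : Type) (F : set_system T)
    {FF : Filter F} (A : T -> 'M[R]_(m, n)) (M : 'M[R]_(m, n)) i j :
  A t @[t --> F] --> M -> A t i j @[t --> F] --> M i j.
Proof.
move=> AM; apply: (cvg_comp _ (fun N : 'M[R]_(m, n) => N i j) AM).
exact: coord_continuous.
Qed.

Lemma cvg_mx (R : realType) (m n : nat) (T : Type) (F : set_system T)
    {FF : Filter F} (A : T -> 'M[R]_(m, n)) (M : 'M[R]_(m, n)) :
  (forall i j, A t i j @[t --> F] --> M i j) -> A t @[t --> F] --> M.
Proof.
move=> AM; apply/cvgrPdist_le => e e0.
have : \forall t \near F, forall ij : 'I_m * 'I_n,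
    `|M ij.1 ij.2 - A t ij.1 ij.2| <= e.
  apply: filter_forall => -[i j] /=.
  by have /cvgrPdist_le/(_ _ e0) := AM i j.
apply: filterS => t Mt; apply: mx_norm_le; first exact: ltW.
by move=> i j; have := Mt (i, j); rewrite !mxE.
Qed.

Lemma cvg_trmx (R : realType) (m n : nat) (T : Type) (F : set_system T)
    {FF : Filter F} (A : T -> 'M[R]_(m, n)) (M : 'M[R]_(m, n)) :
  A t @[t --> F] --> M -> (A t)^T @[t --> F] --> M^T.
Proof.
move=> AM; apply: cvg_mx => i j; rewrite mxE.
under eq_fun do rewrite mxE.
exact: cvg_coord.
Qed.

Lemma cvg_mulmx (R : realType) (m n p : nat) (T : Type) (F : set_system T)
    {FF : Filter F} (A : T -> 'M[R]_(m, n)) (M : 'M[R]_(m, n))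
    (B : T -> 'M[R]_(n, p)) (N : 'M[R]_(n, p)) :
  A t @[t --> F] --> M -> B t @[t --> F] --> N ->
  A t *m B t @[t --> F] --> M *m N.
Proof.
move=> AM BN; apply: cvg_mx => i j; rewrite mxE.
under eq_fun do rewrite mxE.
apply: cvg_big => [|k _]; first exact: add_continuous.
by apply: cvgM; exact: cvg_coord.
Qed.

(** Heine-Borel for row vectors is carried over by transposition, which is continuous and preserves
    coordinate bounds. *)
Lemma cV_bounded_closed_compact (R : realType) (n : nat)
    (A : set 'cV[R]_n) (B : R) :
  (forall v, A v -> `|v| <= B) -> closed A -> compact A.
Proof.
move=> AB Acl.
have ctr k l : continuous (fun v : 'M[R]_(k, l) => v^T).
  by move=> v; exact: (@cvg_trmx _ _ _ _ (nbhs v) _ id v cvg_id).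
rewrite (_ : A = (fun v : 'rV[R]_n => v^T) @` [set v | A v^T]); last first.
  apply/seteqP; split=> [v Av|_ [v Av <-] //].
  by exists v^T; rewrite /= trmxK.
apply: continuous_compact; first exact/continuous_subspaceT/ctr.
apply: bounded_closed_compact.
  exists B; split=> [|M BM v /= Av]; first exact: num_real.
  have B0 : 0 <= B by apply: le_trans (AB _ Av).
  apply: mx_norm_le => [|i j]; first exact: (le_trans B0 (ltW BM)).
  apply: le_trans (ltW BM); apply: le_trans (AB _ Av).
  by have := coord_norm_le v^T j i; rewrite mxE.
by apply: closed_comp => // v _; exact: ctr.
Qed.

Lemma compact_fun_bounded (R : realType) (T : topologicalType) (V : normedModType R)
    (A : set T) (f : T -> V) :
  compact A -> continuous f -> exists2 M : R, 0 < M & forall v, A v -> `|f v| <= M.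
Proof.
move=> cA cf.
have /compact_bounded [M [_ MA]] : compact (f @` A).
  by apply: continuous_compact => //; exact: continuous_subspaceT.
exists (`|M| + 1); first by rewrite ltr_wpDl.
move=> v Av; apply: MA; last by exists v.
by rewrite ltr_pwDr// ler_norm.
Qed.

Lemma locally_lipschitz_continuous (R : realType) (V W : normedModType R)
    (f : V -> W) :
  [locally [lipschitz f v | v in [set: V]]] -> continuous f.
Proof.
move=> lf v; have := lf (v, v) (conj I I).
move=> - [M0 [_ /(_ (Num.max M0 0 + 1))]].
(* This constant lies above [M0], hence is an admissible Lipschitz constant, and is positive, so
   that one can divide by it. *)
have M1 : M0 < Num.max M0 0 + 1.
  by rewrite (@le_lt_trans _ _ (Num.max M0 0))// ?ltrDl// le_max lexx.
have K0 : 0 < Num.max M0 0 + 1 by rewrite ltr_wpDl// le_max lexx orbT.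
move: (Num.max M0 0 + 1) K0 M1 => K K0 M1 /(_ M1).
rewrite /dominated_by /within /= => vvK.
have vK : \forall u \near v, `|f v - f u| <= K * `|v - u|.
  have : (v, u) @[u --> v] --> (v, v).
    by apply: cvg_pair; [exact: cvg_cst|exact: cvg_id].
  move/(_ _ vvK) => /=; rewrite nbhs_simpl /=.
  by apply: filterS => u /(_ (conj I I)).
apply/cvgrPdist_le => e e0; near=> u.
apply: (@le_trans _ _ (K * `|v - u|)); first by near: u.
rewrite mulrC -ler_pdivlMr//; near: u.
by apply: cvgr_dist_le; [exact: cvg_id|exact: divr_gt0].
Unshelve. all: by end_near. Qed.

(** * Differentiable concave functions *)

Section concave.
Variables (R : realType) (n : nat) (rho : 'cV[R]_n -> R).
Hypothesis rho_diff : forall v, differentiable rho v.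
Hypothesis rho_concave : forall v1 v2 (k : R), 0 <= k <= 1 ->
  k * rho v1 + (1 - k) * rho v2 <= rho (k *: v1 + (1 - k) *: v2).

(** By concavity the difference quotients along [u] with steps in []0, 1]] are at least
    [rho (v + u) - rho v]; the step then tends to 0 from the right. *)
Lemma concave_le_derive v u : rho (v + u) <= rho v + 'D_u rho v.
Proof.
rewrite -lerBlDl.
have : h^-1 *: ((rho \o shift v) (h *: u) - rho v) @[h --> 0^'+] --> 'D_u rho v.
  by apply: cvg_dnbhs_at_right; exact: diff_derivable.
move=> /cvgr_to_ge; apply; near=> h.
have h0 : 0 < h by [].
rewrite /= /GRing.scale /= mulrC ler_pdivlMr//.
have : 0 <= h <= 1.
  by rewrite ltW//=; near: h; apply: nbhs_right_le.
move=> /(rho_concave (v + u) v).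
rewrite (_ : _ + (1 - h) *: v = h *: u + v); last first.
  by rewrite scalerDr scalerBl scale1r addrC addrA subrK addrC.
lra.
Unshelve. all: by end_near. Qed.

Lemma derive_gradient v u : 'D_u rho v = ((gradient rho v)^T *m u) 0 0.
Proof.
rewrite deriveE//.
have -> : u = \sum_i u i 0 *: (delta_mx i 0 : 'cV[R]_n).
  rewrite [LHS]matrix_sum_delta; apply: eq_bigr => i _.
  by rewrite big_ord1.
rewrite linear_sum /= mulmx_sumr summxE; apply: eq_bigr => i _.
rewrite linearZ /= -scalemxAr mxE; congr (_ * _).
rewrite mxE (bigD1 i)//= !mxE !eqxx mulr1 big1 ?addr0 ?deriveE// => j ji.
by rewrite !mxE (negbTE ji) mulr0.
Qed.

Lemma concave_le_gradient v z :
  rho z <= rho v + ((gradient rho v)^T *m (z - v)) 0 0.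
Proof. by rewrite -derive_gradient -{1}(subrK v z) addrC concave_le_derive. Qed.

(** A critical point of a concave function is a global maximum, which [z] rules out. *)
Lemma gradient_neq0 v z : rho v < rho z -> gradient rho v != 0.
Proof.
apply: contraTneq => g0; rewrite -leNgt.
by have := concave_le_gradient v z; rewrite g0 trmx0 mul0mx mxE addr0.
Qed.

Let rho_continuous : continuous rho.
Proof. by move=> v; exact: (differentiable_continuous (rho_diff v)). Qed.

(** By concavity the derivative at [z] lies between the difference quotients with steps [h] and
    [- h]. For a fixed small [h] these are close to the derivative at [v] when taken at [v], and
    they depend continuously on the base point. *)
Lemma near_concave_derive (u v : 'cV[R]_n) (e : R) : 0 < e ->
  \forall z \near v, `|'D_u rho v - 'D_u rho z| <= e.
Proof.
move=> e0.
have quot : h^-1 *: ((rho \o shift v) (h *: u) - rho v) @[h --> 0^'] --> 'D_u rho v.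
  exact: diff_derivable.
have [d /= d0 dP] : \forall h \near 0^',
    `|'D_u rho v - h^-1 *: ((rho \o shift v) (h *: u) - rho v)| <= e / 2.
  by apply: (cvgr_dist_le _ _ quot); rewrite divr_gt0.
pose h := d / 2.
have h0 : 0 < h by rewrite divr_gt0.
have hd k : `|k| = h -> `|'D_u rho v - k^-1 * (rho (v + k *: u) - rho v)| <= e / 2.
  move=> kh; rewrite [v + _]addrC; apply: dP.
    by rewrite /= sub0r normrN kh /h ltr_pdivrMr// ltr_pMr// ltr1n.
  by rewrite -normr_gt0 kh.
pose q k := fun z : 'cV[R]_n => k^-1 * (rho (z + k *: u) - rho z).
have slope k : q k z @[z --> v] --> q k v.
  rewrite /q; apply: (@cvgM _ _ (nbhs v)); first exact: cvg_cst.
  apply: (@cvgB _ _ _ (nbhs v)); last exact: rho_continuous.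
  have shiftk : (fun z => z + k *: u) z @[z --> v] --> v + k *: u.
    by apply: (@cvgD _ _ _ (nbhs v)); [exact: cvg_id|exact: cvg_cst].
  exact: (cvg_comp _ rho shiftk (@rho_continuous _)).
have e2 : 0 < e / 2 by rewrite divr_gt0.
near=> z.
have /ler_normlP [h1 h2] := hd h (gtr0_norm h0).
have /ler_normlP [h3 h4] : `|'D_u rho v - (- h)^-1 * (rho (v + - h *: u) - rho v)| <= e / 2.
  by apply: hd; rewrite normrN gtr0_norm.
have /ler_normlP [h5 h6] : `|h^-1 * (rho (v + h *: u) - rho v) -
   h^-1 * (rho (z + h *: u) - rho z)| <= e / 2.
  by near: z; apply: (cvgr_dist_le _ _ (slope h)).
have /ler_normlP [h7 h8] : `|(- h)^-1 * (rho (v + - h *: u) - rho v) -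
   (- h)^-1 * (rho (z + - h *: u) - rho z)| <= e / 2.
  by near: z; apply: (cvgr_dist_le _ _ (slope (- h))).
have DZ k : rho (z + k *: u) - rho z <= k * 'D_u rho z.
  rewrite lerBlDl; apply: le_trans (concave_le_derive _ _) _.
  by rewrite !deriveE// linearZ.
have up : h^-1 * (rho (z + h *: u) - rho z) <= 'D_u rho z.
  by rewrite mulrC ler_pdivrMr// mulrC DZ.
have lo : 'D_u rho z <= (- h)^-1 * (rho (z + - h *: u) - rho z).
  have DZh := DZ (- h).
  by rewrite invrN mulNr -mulrN [_^-1 * _]mulrC ler_pdivlMr//; lra.
by apply/ler_normlP; split; lra.
Unshelve. all: by end_near. Qed.

Lemma gradient_continuous : continuous (gradient rho).
Proof.
move=> v; apply: (@cvg_mx _ _ _ _ (nbhs v) _ (gradient rho)) => i j.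
apply/cvgrPdist_le => e /(near_concave_derive (delta_mx i 0) v).
by apply: filterS => z; rewrite !mxE.
Qed.

(** Contracting the superlevel set [L] towards [z] by a fixed ratio [k] brings it into the positive
    set, which has bound [C]; undoing the contraction costs the factor [k^-1]. *)
Lemma superlevel_bounded (C : R) (L : R) z :
  (forall v, 0 < rho v -> `|v| <= C) -> 0 < rho z ->
  exists B, forall v, L <= rho v -> `|v| <= B.
Proof.
move=> posC z0.
(* With this ratio, concavity gives at least [rho z - k * (rho z + |L|) = k > 0] at the contracted
   point. *)
pose k := rho z / (rho z + `|L| + 1).
have d0 : 0 < rho z + `|L| + 1 by rewrite ltr_pwDr// addr_ge0// ltW.
have k0 : 0 < k by rewrite divr_gt0.
have k1 : k <= 1 by rewrite ler_pdivrMr// mul1r -addrA lerDl addr_ge0.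
have kL : k * (rho z + `|L| + 1) = rho z by rewrite divfK// gt_eqF.
exists (`|z| + k^-1 * (C + `|z|)) => v Lv.
have : 0 < rho (k *: v + (1 - k) *: z).
  have k01 : 0 <= k <= 1 by rewrite ltW.
  apply: lt_le_trans (rho_concave v z k01).
  have : - `|L| <= L by rewrite lerNl ler_normr lexx orbT.
  move=> nL; have : k * (- `|L|) <= k * rho v.
    by rewrite ler_pM2l// (le_trans nL).
  lra.
move=> /posC; rewrite (_ : k *: v + _ = z + k *: (v - z)); last first.
  by rewrite scalerBl scale1r scalerBr addrCA.
move=> vC.
have : `|k *: (v - z)| <= C + `|z|.
  rewrite -(addrK z (k *: (v - z))) [_ + z]addrC.
  by apply: le_trans (ler_normB _ _) _; rewrite lerD2r.
rewrite normrZ gtr0_norm// => kvz.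
rewrite -{1}(subrK z v) addrC; apply: le_trans (ler_normD _ _) _.
by rewrite lerD2l mulrC ler_pdivlMr// mulrC.
Qed.

End concave.

(** * Peano's existence theorem *)

(** A cluster point of an ultrafilter is a limit: otherwise the complement of some neighbourhood
    would belong to the ultrafilter and meet that neighbourhood. *)
Lemma ultra_cvg_compact (T : Type) (V : topologicalType) (U : set_system T)
    (f : T -> V) (A : set V) :
  UltraFilter U -> compact A -> (forall t, A (f t)) ->
  exists p : V, f t @[t --> U] --> p.
Proof.
move=> UU cA Af; have [p [_ pU]] := cA (f @ U) _ (filterE _ Af).
exists p => B Bp; change (U (f @^-1` B)).
have [//|nB] := @in_ultra_setVsetC _ U (f @^-1` B) UU.
by have [v []] := pU (~` B) B nB Bp.
Qed.

Section peano.
Variables (R : realType) (n : nat) (H : 'cV[R]_n -> R -> 'cV[R]_n) (M : R).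
Variable y0 : 'cV[R]_n.
Hypothesis H_continuous : forall y t,
  H z.1 z.2 @[z --> ((y, t) : 'cV[R]_n * R)] --> H y t.
Hypothesis H_bounded : forall y t, `|H y t| <= M.

Fixpoint euler (h : R) (j : nat) : 'cV[R]_n :=
  if j is j'.+1 then euler h j' + h *: H (euler h j') (j'%:R * h) else y0.

(** Serves twice: [c = 0] and [e = M] give the Lipschitz bound, and [c = H (x s) s] gives the slope
    of the limit at [s]. *)
Lemma euler_increment (h e : R) (c : 'cV[R]_n) (i d : nat) : 0 <= h ->
  (forall k, (i <= k < i + d)%N -> `|H (euler h k) (k%:R * h) - c| <= e) ->
  `|euler h (i + d) - euler h i - (d%:R * h) *: c| <= d%:R * h * e.
Proof.
move=> h0; elim: d => [|d IH] He.
  by rewrite addn0 subrr mul0r scale0r subr0 normr0 mul0r.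
rewrite addnS /=.
rewrite (_ : _ - _ = euler h (i + d) - euler h i - (d%:R * h) *: c +
    h *: (H (euler h (i + d)) ((i + d)%:R * h) - c)); last first.
  rewrite -natr1 mulrDl mul1r scalerDl scalerBr opprD.
  by rewrite -!addrA; congr (_ + _); rewrite addrCA; congr (_ + _); rewrite addrCA.
apply: le_trans (ler_normD _ _) _.
rewrite -natr1 mulrDl mul1r mulrDl lerD//.
  by apply: IH => k /andP[ik kd]; apply: He; rewrite ik addnS ltnS ltnW.
rewrite normrZ ger0_norm// ler_wpM2l// He// leq_addr addnS leqnn//.
Qed.

Let M_ge0 : 0 <= M. Proof. exact: le_trans (H_bounded 0 0). Qed.

Let mesh (k : nat) : R := k.+1%:R^-1.

Let mesh_gt0 k : 0 < mesh k. Proof. by rewrite invr_gt0. Qed.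

Let node (k : nat) (t : R) : nat := Num.truncn (t * k.+1%:R).

Let node_lower k t : t < ((node k t)%:R + 1) * mesh k.
Proof. by rewrite ltr_pdivlMr// natr1 truncnS_gt. Qed.

Let node_upper k t : 0 <= t -> (node k t)%:R * mesh k <= t.
Proof. by move=> t0; rewrite ler_pdivrMr// truncn_le mulr_ge0. Qed.

Let node_le k s t : s <= t -> (node k s <= node k t)%N.
Proof. by move=> st; apply: le_truncn; rewrite ler_pM2r. Qed.

Let node_dist k s t : 0 <= s -> s <= t ->
  `|(t - s) - (node k t - node k s)%:R * mesh k| <= mesh k.
Proof.
move=> s0 st; rewrite natrB ?node_le//.
have := node_lower k s; have := node_lower k t.
have := node_upper k s0; have := node_upper k (le_trans s0 st).
by move=> *; apply/ler_normlP; split; lra.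
Qed.

(** Piecewise constant interpolation of the Euler nodes; its jumps account for the extra [mesh k] in
    the Lipschitz bound and disappear in the limit. *)
Let X (k : nat) (t : R) : 'cV[R]_n := euler (mesh k) (node k t).

Let euler_lipschitz k i j : (i <= j)%N ->
  `|euler (mesh k) j - euler (mesh k) i| <= (j - i)%:R * mesh k * M.
Proof.
move=> ij.
have := @euler_increment (mesh k) M 0 i (j - i) (ltW (mesh_gt0 k)).
by rewrite subnKC// scaler0 subr0; apply => l _; rewrite subr0.
Qed.

Let X_lipschitz k s t : 0 <= s -> s <= t -> `|X k t - X k s| <= (t - s + mesh k) * M.
Proof.
move=> s0 st; apply: le_trans (euler_lipschitz _ (node_le k st)) _.
rewrite ler_wpM2r//.
by have /ler_normlP[] := node_dist k s0 st; lra.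
Qed.

Let X_0 k : X k 0 = y0.
Proof. by rewrite /X /node mul0r truncn0. Qed.

Let mesh_cvg0 : mesh k @[k --> \oo] --> 0.
Proof. exact: cvg_harmonic. Qed.

(* An ultrafilter limit at each time separately can replace the Arzela-Ascoli
   extraction, because each estimate to be passed to the limit involves only
   finitely many times. *)
Let peano_limit : exists (U : set_system nat) (x : R -> 'cV[R]_n),
  [/\ ProperFilter U, \oo `<=` U &
      forall t, 0 <= t -> X k t @[k --> U] --> x t].
Proof.
have [U [UU oU]] := @ultraFilterLemma nat \oo _.
have lim t : exists p : 'cV[R]_n, 0 <= t -> X k t @[k --> U] --> p.
  have [t0|_] := leP 0 t; last by exists 0.
  (* The summand 1 absorbs [mesh k <= 1]. *)
  pose B := `|y0| + (t + 1) * M.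
  have cB : compact [set v : 'cV[R]_n | `|v| <= B].
    apply: (@cV_bounded_closed_compact _ _ _ B) => //.
    apply: (@preimage_closed _ _ (@Num.norm _ 'cV[R]_n) [set z : R | z <= B]).
      by move=> v _; exact: norm_continuous.
    exact: closed_le.
  have [|p pU] := @ultra_cvg_compact _ _ U (X ^~ t) _ UU cB; last by exists p.
  move=> k; rewrite /= -(subrK y0 (X k t)) addrC.
  apply: le_trans (ler_normD _ _) _; rewrite lerD2l -(X_0 k).
  apply: le_trans (X_lipschitz k (lexx 0) t0) _.
  rewrite ler_wpM2r// subr0 lerD2l.
  by rewrite invf_le1// ler1n.
have [x xP] := choice lim.
by exists U, x; split => //; exact: ultra_proper.
Qed.

(** * Passage to the limit in the Euler scheme *)

Section limit.
Variables (U : set_system nat) (x : R -> 'cV[R]_n).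
Hypotheses (U_proper : ProperFilter U) (oU : \oo `<=` U).
Hypothesis X_cvg : forall t, 0 <= t -> X k t @[k --> U] --> x t.

Let mesh_cvg : mesh k @[k --> U] --> 0.
Proof. by move=> B /mesh_cvg0 /oU. Qed.

Let limit_lipschitz s t : 0 <= s -> s <= t -> `|x t - x s| <= (t - s) * M.
Proof.
move=> s0 st; rewrite -[t - s]addr0.
apply: (@ler_cvg_to _ U _ _ (fun k => `|X k t - X k s|)
    (fun k => (t - s + mesh k) * M)).
- exact: (cvg_norm (cvgB (X_cvg (le_trans s0 st)) (X_cvg s0))).
- exact: (cvgM (cvgD (cvg_cst _) mesh_cvg) (cvg_cst _)).
- by apply: nearW => k; exact: X_lipschitz.
Qed.

Let node_cvg s t : 0 <= s -> s <= t ->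
  (node k t - node k s)%:R * mesh k @[k --> U] --> t - s.
Proof.
move=> s0 st; apply/cvgrPdist_le => e e0.
near=> k; apply: le_trans (node_dist k s0 st) _.
by near: k; exact: cvgr_le mesh_cvg _ e0.
Unshelve. all: by end_near. Qed.

(** Near time [s] the Euler nodes stay close to [x s], where by continuity the field differs from
    [H (x s) s] by at most [e]. The resulting increment bound passes to the limit using the times
    [a], [b] and [s] only. *)
Let limit_slope s (e : R) : 0 <= s -> 0 < e -> exists2 eta, 0 < eta &
  forall a b, 0 <= a -> a <= b -> s - eta <= a -> b <= s + eta ->
    `|x b - x a - (b - a) *: H (x s) s| <= (b - a) * e.
Proof.
move=> s0 e0.
have [eta1 /= eta10 Heta] : exists2 eta1, 0 < eta1 & forall y t,
    `|x s - y| < eta1 -> `|s - t| < eta1 -> `|H y t - H (x s) s| <= e.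
  have : nbhs ((x s, s) : 'cV[R]_n * R)
      [set p | `|H p.1 p.2 - H (x s) s| <= e].
    exact: (cvgr_distC_le _ _ (@H_continuous (x s) s) _ e0).
  rewrite -nbhs_ballE => -[d /= d0 dP]; exists d => // y t yd td.
  by apply: (dP (y, t)); split; rewrite /= -ball_normE.
(* Once the mesh is below [eta], the nodes involved have times within [2 * eta] of [s] and states
   within [2 * eta * M] of [X k s]. The factor 4 keeps both deviations below [eta1], including the
   distance [eta1 / 4] from [X k s] to [x s]. *)
pose eta := eta1 / (4 * (M + 1)).
have M1 : 0 < M + 1 by rewrite ltr_wpDl.
have eta0 : 0 < eta by rewrite divr_gt0// mulr_gt0.
have etaM : eta * (M + 1) = eta1 / 4.
  by rewrite /eta; field; rewrite gt_eqF.
have etaM0 : 0 <= eta * M by rewrite mulr_ge0// ltW.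
exists eta => // a b a0 ab sa bs.
have b0 : 0 <= b by exact: le_trans ab.
apply: (@ler_cvg_to _ U _ _ (fun k => `|X k b - X k a -
    ((node k b - node k a)%:R * mesh k) *: H (x s) s|)
    (fun k => (node k b - node k a)%:R * mesh k * e)).
- apply: cvg_norm; apply: cvgB (cvgB (X_cvg b0) (X_cvg a0)) _.
  exact: (cvgZ (node_cvg a0 ab) (cvg_cst _)).
- exact: (cvgM (node_cvg a0 ab) (cvg_cst _)).
have eta40 : 0 < eta1 / 4 by rewrite divr_gt0.
near=> k.
have hk : mesh k <= eta.
  by near: k; exact: cvgr_le mesh_cvg _ eta0.
have Xs : `|x s - X k s| <= eta1 / 4.
  by near: k; exact: (cvgr_dist_le _ _ (X_cvg s0)).
have := @euler_increment (mesh k) e (H (x s) s) (node k a)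
  (node k b - node k a) (ltW (mesh_gt0 k)).
rewrite subnKC; last exact: node_le.
apply => l /andP[al lb].
have al' : (node k a)%:R * mesh k <= l%:R * mesh k.
  by rewrite ler_pM2r// ler_nat.
have lb' : l%:R * mesh k <= (node k b)%:R * mesh k.
  by rewrite ler_pM2r// ler_nat ltnW.
have bu := node_upper k b0; have al2 := node_lower k a.
have su := node_upper k s0; have sl2 := node_lower k s.
apply: Heta; last by apply/ltr_normlP; split; lra.
have ls : `|X k s - euler (mesh k) l| <= 2 * eta * M.
  have [ls|/ltnW ls] := leqP l (node k s).
    apply: le_trans (euler_lipschitz k ls) _; rewrite ler_wpM2r//.
    by rewrite natrB// mulrBl; lra.
  rewrite distrC; apply: le_trans (euler_lipschitz k ls) _.
  by rewrite ler_wpM2r// natrB// mulrBl; lra.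
rewrite -(subrK (X k s) (x s)) -addrA.
apply: le_lt_trans (ler_normD _ _) _; lra.
Unshelve. all: by end_near. Qed.

(** The constant extension to negative times is continuous on the whole line. *)
Let z (t : R) : 'cV[R]_n := x (Num.max 0 t).

Let zE t : 0 <= t -> z t = x t.
Proof. by move=> t0; rewrite /z max_r. Qed.

Let z_0 : z 0 = y0.
Proof.
rewrite zE//; apply/eqP; rewrite -subr_eq0 -normr_le0.
apply: (cvgr_to_le (cvg_norm (cvgB (X_cvg (lexx 0)) (cvg_cst y0)))).
by apply: nearW => k; rewrite !fctE X_0 subrr normr0.
Qed.

Let z_lipschitz s t : `|z t - z s| <= `|t - s| * M.
Proof.
wlog st : s t / s <= t.
  by have [st|/ltW ts] := leP s t => [|+]; [apply|rewrite distrC [`|t - s|]distrC; apply].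
have le_max0 : Num.max 0 s <= Num.max 0 t by rewrite ge_max !le_max lexx st !orbT.
apply: le_trans (limit_lipschitz _ le_max0) _; first by rewrite le_max lexx.
rewrite ler_wpM2r// ger0_norm ?subr_ge0//.
by have [s0|s0] := leP 0 s; have [t0|t0] := leP 0 t; lra.
Qed.

Let z_continuous : continuous z.
Proof.
move=> s; apply/cvgrPdist_le => e e0; near=> t.
apply: le_trans (z_lipschitz _ _) _.
apply: (@le_trans _ _ (`|s - t| * (M + 1))); first by rewrite ler_wpM2l// lerDl.
rewrite -ler_pdivlMr ?ltr_wpDl//; near: t.
by apply: (cvgr_dist_le _ _ cvg_id); rewrite divr_gt0// ltr_wpDl.
Unshelve. all: by end_near. Qed.

(** The slope estimate makes [z] differentiable at positive times with derivative given by the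
    field; the fundamental theorem of calculus then yields the integral form. *)
Lemma limit_integral : exists z : R -> 'cV[R]_n, continuous z /\
  forall (t : R) i, 0 <= t ->
    z t i 0 = y0 i 0 + \int[lebesgue_measure]_(s in `[0, t]) H (z s) s i 0.
Proof.
exists z; split => // t i; rewrite le_eqVlt => /predU1P[<-|t0].
  by rewrite set_itv1 Rintegral_set1 addr0 z_0.
have cvgH s : H (z t) t i 0 @[t --> s] --> H (z s) s i 0.
  apply: (@cvg_coord _ _ _ _ (nbhs s) _ (fun t => H (z t) t)).
  have zs : (z t, t) @[t --> s] --> ((z s, s) : 'cV[R]_n * R).
    exact: (cvg_pair (@z_continuous s) cvg_id).
  exact: (cvg_comp _ (fun p => H p.1 p.2) zs (@H_continuous _ _)).
have zi s : z t i 0 @[t --> s] --> z s i 0.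
  by apply: (@cvg_coord _ _ _ _ (nbhs s) _ z); exact: z_continuous.
have dz s : 0 < s -> h^-1 *: (z (h + s) i 0 - z s i 0) @[h --> 0^'] -->
    H (z s) s i 0.
  move=> s0; apply/cvgrPdist_le => e e0.
  have [eta eta0 etaP] := limit_slope (ltW s0) e0.
  near=> h.
  have h0 : h != 0 by near: h; exact: nbhs_dnbhs_neq.
  have hs : `|h| <= Num.min eta s.
    near: h; apply: dnbhs0_le.
    by rewrite lt_min eta0.
  have /andP[he hs'] : (`|h| <= eta) && (`|h| <= s) by rewrite -le_min.
  have /ler_normlP[h1 h2] := he; have /ler_normlP[h3 h4] := hs'.
  have sh0 : 0 <= h + s by lra.
  have hc : `|z (h + s) - z s - h *: H (z s) s| <= `|h| * e.
    rewrite !zE//; last exact: ltW.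
    (* The slope estimate is applied on [[s, s + h]] or on [[s + h, s]], according to the sign of
       [h]. *)
    have [hge0|hlt0] := leP 0 h.
      have := etaP s (h + s) (ltW s0); rewrite addrK ger0_norm//.
      by apply; lra.
    have := etaP (h + s) s sh0; rewrite (_ : s - (h + s) = - h); last by ring.
    rewrite ltr0_norm// => slope; rewrite -normrN.
    rewrite (_ : - (_ - _) = x s - x (h + s) - (- h) *: H (x s) s).
      by apply: slope; lra.
    by rewrite scaleNr !opprB opprK addrC.
  rewrite -(ler_pM2l (_ : 0 < `|h|)) ?normr_gt0// -normrM.
  apply: le_trans hc; apply: le_trans (coord_norm_le _ i 0); rewrite !mxE.
  by rewrite mulrBr /GRing.scale /= mulrA divff// mul1r distrC.
rewrite /Rintegral (@continuous_FTC2 _ _ (fun s => z s i 0))//=.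
- by rewrite z_0 [RHS]addrC subrK.
- exact: continuous_subspaceT.
- split=> [s||].
  + rewrite in_itv/= => /andP[s0 _].
    apply/cvg_ex; exists (H (z s) s i 0) => /=.
    under eq_fun do rewrite [_ *: 1]mulr1.
    exact: dz.
  + exact/cvg_at_right_filter/zi.
  + exact/cvg_at_left_filter/zi.
- move=> s; rewrite in_itv/= => /andP[s0 _].
  by apply/cvg_lim; [exact: Rhausdorff|exact: dz].
Unshelve. all: by end_near. Qed.

End limit.

Lemma peano : exists z : R -> 'cV[R]_n, continuous z /\
  forall (t : R) i, 0 <= t ->
    z t i 0 = y0 i 0 + \int[lebesgue_measure]_(s in `[0, t]) H (z s) s i 0.
Proof. by have [U [x [PU oU xP]]] := peano_limit; exact: limit_integral xP. Qed.

End peano.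

(** * Caratheodory solutions *)

Definition dot (R : realType) (n : nat) (u v : 'cV[R]_n) : R := (u^T *m v) 0 0.

Lemma dotE (R : realType) (n : nat) (u v : 'cV[R]_n) :
  dot u v = \sum_i u i 0 * v i 0.
Proof. by rewrite /dot mxE; apply: eq_bigr => i _; rewrite mxE. Qed.

Lemma dotDr (R : realType) (n : nat) (u v w : 'cV[R]_n) :
  dot u (v + w) = dot u v + dot u w.
Proof. by rewrite /dot mulmxDr mxE. Qed.

Lemma dotNr (R : realType) (n : nat) (u v : 'cV[R]_n) : dot u (- v) = - dot u v.
Proof. by rewrite /dot mulmxN mxE. Qed.

Lemma dotZr (R : realType) (n : nat) (k : R) (u v : 'cV[R]_n) :
  dot u (k *: v) = k * dot u v.
Proof. by rewrite /dot -scalemxAr mxE. Qed.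

Lemma dotNl (R : realType) (n : nat) (u v : 'cV[R]_n) : dot (- u) v = - dot u v.
Proof. by rewrite /dot linearN mulNmx mxE. Qed.

Lemma dot_le (R : realType) (n : nat) (u v : 'cV[R]_n) (a b : R) :
  `|u| <= a -> `|v| <= b -> `|dot u v| <= n%:R * (a * b).
Proof.
move=> ua vb; rewrite dotE; apply: le_trans (ler_norm_sum _ _ _) _.
rewrite mulr_natl -[X in _ <= _ *+ X]card_ord -sumr_const; apply: ler_sum => i _.
by rewrite normrM ler_pM// (le_trans (coord_norm_le _ _ _)).
Qed.

Lemma cvg_dot (R : realType) (n : nat) (T : Type) (F : set_system T)
    {FF : Filter F} (u v : T -> 'cV[R]_n) (p q : 'cV[R]_n) :
  u t @[t --> F] --> p -> v t @[t --> F] --> q ->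
  dot (u t) (v t) @[t --> F] --> dot p q.
Proof. by move=> up vq; exact: cvg_coord 0 0 (cvg_mulmx (cvg_trmx up) vq). Qed.

Lemma max0_continuous (R : realType) : continuous (fun t : R => Num.max 0 t).
Proof.
move=> s; apply: (@continuous_max _ _ (cst 0) id); first exact: cvg_cst.
exact: cvg_id.
Qed.

Lemma Rintegral_sum d (T : measurableType d) (R : realType)
    (mu : {measure set T -> \bar R}) (I : Type) (r : seq I) (D : set T)
    (G : I -> T -> R) :
  measurable D -> (forall i, mu.-integrable D (EFin \o G i)) ->
  mu.-integrable D (EFin \o (fun t => \sum_(i <- r) G i t)) /\
  \int[mu]_(t in D) (\sum_(i <- r) G i t) = \sum_(i <- r) \int[mu]_(t in D) G i t.
Proof.
move=> mD intG; elim: r => [|i r [IHi IHe]].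
  rewrite big_nil (_ : (fun t => _) = cst 0).
    by split; [exact: integrable0|rewrite Rintegral_cst// mul0r].
  by apply/funext => t; rewrite big_nil.
rewrite big_cons (_ : (fun t => _) = (fun t => G i t + \sum_(j <- r) G j t)).
  by split; [exact: (integrableD mD (intG i) IHi)|rewrite RintegralD// IHe].
by apply/funext => t; rewrite big_cons.
Qed.

Section solution.
Variables (R : realType) (n : nat).
Notation mu := (@lebesgue_measure R).

(** * Continuity and increments of solutions *)

Section increment.
Variables (F : 'cV[R]_n -> R -> 'cV[R]_n) (x0 : 'cV[R]_n) (x : R -> 'cV[R]_n).
Hypothesis x_solution : solution F x0 x.

Lemma solution_continuous :
  continuous ((fun t => x (Num.max 0 t)) : R -> 'cV[R]_n).
Proof.
move=> s; apply: (@cvg_mx _ _ _ _ (nbhs s) _ (fun t => x (Num.max 0 t))) => i j.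
rewrite ord1 {j}; apply/cvgrPdist_le => e e0.
(* The margin 1 puts [Num.max 0 t] in [[0, T]] for all [t] near [s]. *)
pose T := Num.max 0 s + 1.
have m0 r : 0 <= Num.max 0 r :> R by rewrite le_max lexx.
have T0 : 0 <= T by rewrite addr_ge0.
have /(parameterized_integral_continuous T0)/subspace_continuousP :=
  (x_solution i T0).1.
move=> /(_ (Num.max 0 s)); rewrite /= in_itv/= m0 lerDl ler01 => /(_ erefl).
move=> /cvgrPdist_le/(_ _ e0); rewrite near_withinE => near_s.
have max_cvg := @max0_continuous R s.
have maxT : \forall t \near s, Num.max 0 t <= T.
  by apply: (cvgr_le _ max_cvg); rewrite ltrDl.
have := max_cvg _ near_s; rewrite near_simpl.
apply: filterS2 maxT => t tT /(_ _)/=; rewrite in_itv/= m0 tT => /(_ erefl).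
rewrite /parameterized_integral.
by rewrite (x_solution i (m0 s)).2 (x_solution i (m0 t)).2 opprD addrACA subrr add0r.
Qed.

(** Pairing with the fixed vector [p] commutes with integration. The bound is required on the open
    interval only, so that it can be used up to an exit time [t], where confinement fails. *)
Lemma solution_increment (s t k : R) (p : 'cV[R]_n) : 0 <= s -> s <= t ->
  (forall r, s < r < t -> k <= dot p (F (x r) r)) ->
  k * (t - s) <= dot p (x t - x s).
Proof.
move=> s0 st kF.
have t0 := le_trans s0 st.
have intF i : mu.-integrable `]s, t[ (EFin \o (fun r => F (x r) r i 0)).
  apply: integrableS (x_solution i t0).1 => //.
  by apply: subset_itv; rewrite bnd_simp.
have xF i : x t i 0 - x s i 0 = \int[mu]_(r in `]s, t[) F (x r) r i 0.
  rewrite (x_solution i t0).2 (x_solution i s0).2 opprD addrACA subrr add0r.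
  rewrite Rintegral_itvB ?bnd_simp//; last exact: (x_solution i t0).1.
  by rewrite Rintegral_itv_bndo_bndc.
have [intS ->] : mu.-integrable `]s, t[ (EFin \o (fun r => dot p (F (x r) r))) /\
    dot p (x t - x s) = \int[mu]_(r in `]s, t[) dot p (F (x r) r).
  rewrite dotE (_ : (fun r => _) = (fun r => \sum_i p i 0 * F (x r) r i 0)).
    have [] := @Rintegral_sum _ _ _ mu _ (index_enum 'I_n) `]s, t[
      (fun i r => p i 0 * F (x r) r i 0).
    - by [].
    - move=> i.
      by have := @integrableZl _ _ _ mu _ (measurable_itv _) (p i 0) _ (intF i).
    - move=> ? ->; split => //; apply: eq_bigr => i _.
      by rewrite !mxE xF RintegralZl.
  by apply/funext => r; rewrite dotE.
rewrite -(_ : \int[mu]_(r in `]s, t[) k = k * (t - s)).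
  apply: le_Rintegral => //.
    have : mu.-integrable `[s, t] (EFin \o cst k).
      apply: continuous_compact_integrable; first exact: segment_compact.
      by apply: continuous_subspaceT => ?; exact: cvg_cst.
    by apply: integrableS => //; exact: subset_itv_oo_cc.
rewrite Rintegral_cst//= lebesgue_measure_itv/= lte_fin.
by case: ltgtP st => //= -> _; rewrite subrr.
Qed.

End increment.

(** * Existence under bounded measurable noise *)

Section existence.
Variables (W : set 'cV[R]_n) (w : R -> 'cV[R]_n).
Hypotheses (W_bounded : bounded_set W) (w_noise : noise W w).

Lemma noise_bounded : exists2 B : R, 0 < B & forall t, 0 <= t -> `|w t| <= B.
Proof.
have [M [_ MW]] := W_bounded.
exists (`|M| + 1); first by rewrite ltr_wpDl.
move=> t /w_noise.1 Wt; apply: (MW (`|M| + 1)) => //.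
by rewrite ltr_pwDr// ler_norm.
Qed.

Lemma noise_integrable (t : R) (i : 'I_n) : 0 <= t ->
  mu.-integrable `[0, t] (EFin \o (fun s => w s i 0)).
Proof.
move=> t0; have [B B0 wB] := noise_bounded.
apply: measurable_bounded_integrable.
- exact: measurable_itv.
- exact: compact_finite_measure (@segment_compact _ 0 t).
- apply: measurable_funS (w_noise.2 i) => //.
  by apply: subset_itvl; rewrite bnd_simp.
- exists B; split => [|M BM s /=]; first exact: num_real.
  rewrite in_itv/= => /andP[s0 _].
  apply: le_trans (coord_norm_le _ _ _) _.
  by rewrite (le_trans (wB _ s0))// ltW.
Qed.

(* Subtracting the antiderivative of the noise turns the Caratheodory equation
   into one with a continuous right-hand side. *)
Lemma solution_exists (G : 'cV[R]_n -> R -> 'cV[R]_n) (M : R) (x0 : 'cV[R]_n) :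
  (forall y t, G z.1 z.2 @[z --> ((y, t) : 'cV[R]_n * R)] --> G y t) ->
  (forall y t, `|G y t| <= M) ->
  exists x, solution (fun v t => G v t + w t) x0 x.
Proof.
move=> G_continuous G_bounded.
pose om t : 'cV[R]_n := \col_i \int[mu]_(s in `[0, t]) w s i 0.
have om_solution : solution (fun _ t => w t) 0 om.
  by move=> t i t0; split; [exact: noise_integrable|rewrite !mxE add0r].
have om_continuous := solution_continuous om_solution.
pose om0 (t : R) := om (Num.max 0 t).
have shift_cvg y t : (z.1 + om0 z.2, z.2) @[z --> ((y, t) : 'cV[R]_n * R)] -->
    ((y + om0 t, t) : 'cV[R]_n * R).
  have cvg1 : (fun z : 'cV[R]_n * R => z.1) z @[z --> ((y, t) : 'cV[R]_n * R)] --> y.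
    exact: (@cvg_fst _ _ (nbhs y) (nbhs t)).
  have cvg2 : (fun z : 'cV[R]_n * R => z.2) z @[z --> ((y, t) : 'cV[R]_n * R)] --> t.
    exact: (@cvg_snd _ _ (nbhs y) (nbhs t)).
  exact: (cvg_pair (cvgD cvg1 (cvg_comp _ om0 cvg2 (@om_continuous t))) cvg2).
have [||z [z_continuous zE]] := @peano R n (fun y t => G (y + om0 t) t) M x0.
- move=> y t.
  exact: (cvg_comp _ (fun p => G p.1 p.2) (shift_cvg y t) (G_continuous _ _)).
- by move=> y t; exact: G_bounded.
exists (fun t => z t + om0 t) => t i t0.
have intG : mu.-integrable `[0, t] (EFin \o (fun s => G (z s + om0 s) s i 0)).
  apply: continuous_compact_integrable; first exact: segment_compact.
  apply: continuous_subspaceT => s.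
  apply: (@cvg_coord _ _ _ _ (nbhs s) _ (fun s => G (z s + om0 s) s)).
  have pair_cvg : (z s + om0 s, s) @[s --> s] --> ((z s + om0 s, s) : 'cV[R]_n * R).
    exact: (cvg_pair (cvgD (@z_continuous s) (@om_continuous s)) cvg_id).
  exact: (cvg_comp _ (fun p => G p.1 p.2) pair_cvg (G_continuous _ _)).
have intw := noise_integrable i t0.
rewrite (_ : (fun s => _) = (fun s => G (z s + om0 s) s i 0 + w s i 0)); last first.
  by apply/funext => s; rewrite mxE.
split.
  by have := @integrableD _ _ _ mu _ (measurable_itv _) _ _ intG intw.
transitivity (x0 i 0 + \int[mu]_(s in `[0, t]) (G (z s + om0 s) s i 0 + w s i 0));
  last by congr (_ + _); apply: eq_Rintegral => s _ /=; rewrite mxE.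
by rewrite RintegralD// addrA -zE// !mxE max_r.
Qed.

End existence.

End solution.

(** * The logarithmic barrier *)

(** The time is the infimum of the exit times. By continuity [q] is not strictly inside at this
    infimum, while as a limit from the left its value lies in the closed interval, hence is an
    endpoint. *)
Lemma first_exit (R : realType) (q : R -> R) (lo hi t1 : R) : continuous q ->
  lo < q 0 < hi -> 0 <= t1 -> ~ (lo < q t1 < hi) ->
  exists T, [/\ 0 < T, forall s, 0 <= s < T -> lo < q s < hi &
    q T = lo \/ q T = hi].
Proof.
move=> qc q0 t10 qt1.
pose S := [set t | 0 <= t /\ ~ (lo < q t < hi)].
have S0 : S !=set0 by exists t1.
have lbS : lbound S 0 by move=> t [].
have iS : has_inf S by split => //; exists 0.
pose T := inf S.
have T0 : 0 <= T by apply: lb_le_inf.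
have inside s : 0 <= s < T -> lo < q s < hi.
  move=> /andP[s0 sT]; apply: contrapT => qs.
  by have := ge_inf iS.2 (conj s0 qs : S s); rewrite leNgt sT.
have qT : ~ (lo < q T < hi).
  move=> /andP[loT Thi].
  have : \forall t \near T, lo < q t < hi.
    near=> t; apply/andP; split; near: t.
      exact: (cvgr_gt _ (@qc T)).
    exact: (cvgr_lt _ (@qc T)).
  rewrite -nbhs_nearE -nbhs_ballE => -[d /= d0 dq].
  have [t St tT] := inf_adherent d0 iS.
  have Tt := ge_inf iS.2 St; rewrite -/T in tT Tt.
  by apply: St.2; apply: dq; rewrite /ball/=; apply/ltr_normlP; split; lra.
have T_gt0 : 0 < T.
  by rewrite lt_neqAle T0 andbT; apply: contra_notN qT => /eqP <-.
have near_inside : \forall t \near T^'-, lo < q t < hi.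
  near=> t; apply: inside; apply/andP; split => //.
  by apply: ltW; near: t; exact: nbhs_left_gt.
have left_cvg : q t @[t --> T^'-] --> q T by exact/cvg_at_left_filter/qc.
have loT : lo <= q T.
  apply: (cvgr_to_ge left_cvg); apply: filterS near_inside => t.
  by case/andP => /ltW.
have Thi : q T <= hi.
  apply: (cvgr_to_le left_cvg); apply: filterS near_inside => t.
  by case/andP => _ /ltW.
exists T; split => //.
have [->|nlo] := eqVneq (q T) lo; first by left.
have [->|nhi] := eqVneq (q T) hi; first by right.
by case: qT; rewrite !lt_neqAle loT Thi eq_sym nlo nhi.
Unshelve. all: by end_near. Qed.

Section log_barrier.
Variable R : realType.

(* [epsilon psi rho_max gamma v t] unfolds to [log_barrier (xi psi rho_max gamma v t)]. *)
Definition log_barrier (s : R) : R := ln (- ((s + 1) / s)).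

(** At the ends [- d] and [- 1 + d] of the shrunken funnel the barrier takes opposite values, whose
    size [ln ((1 - d) / d)] is arbitrarily large for small [d]. *)
Lemma log_barrier_upper (d : R) : 0 < d < 1 ->
  log_barrier (- d) = ln ((1 - d) / d).
Proof.
by move=> /andP[d0 d1]; rewrite /log_barrier invrN mulrN opprK addrC.
Qed.

Lemma log_barrier_lower (d : R) : 0 < d < 1 ->
  log_barrier (- 1 + d) = - ln ((1 - d) / d).
Proof.
move=> /andP[d0 d1]; rewrite -lnV; last first.
  by rewrite posrE divr_gt0// subr_gt0.
rewrite /log_barrier; congr (ln _).
have dn0 : d != 0 by rewrite gt_eqF.
have dn1 : 1 - d != 0 by rewrite gt_eqF// subr_gt0.
have dn2 : -1 + d != 0 by rewrite lt_eqF//; lra.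
by field; rewrite dn0 dn1 dn2.
Qed.

Lemma log_barrier_continuous (s : R) : -1 < s < 0 ->
  {for s, continuous log_barrier}.
Proof.
move=> /andP[s1 s0].
have num : - ((t + 1) / t) @[t --> s] --> - ((s + 1) / s).
  apply: cvgN; apply: cvgM.
    by apply: cvgD; [exact: cvg_id|exact: cvg_cst].
  by apply: cvgV; [rewrite lt_eqF|exact: cvg_id].
apply: (cvg_comp _ (@ln R) num); apply: continuous_ln.
by rewrite -mulrN -invrN divr_gt0//; lra.
Qed.

Lemma log_barrier_margin (k q : R) : 0 < k -> -1 < q < 0 ->
  exists d, [/\ 0 < d < 1, - 1 + d < q < - d & k <= ln ((1 - d) / d)].
Proof.
move=> k0 /andP[q1 q0].
have e0 : 0 < 1 + expR k by rewrite ltr_pwDl// ltW// expR_gt0.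
(* The first bound is equivalent to [expR k <= (1 - d) / d]; the other two keep [q] strictly
   inside. *)
pose d := Num.min (1 + expR k)^-1 (Num.min ((1 + q) / 2) (- q / 2)).
have d0 : 0 < d by rewrite !lt_min invr_gt0 e0/=; apply/andP; split; lra.
have dq1 : d <= (1 + q) / 2 by rewrite !ge_min lexx orbT.
have dq2 : d <= - q / 2 by rewrite !ge_min lexx !orbT.
have dk : d <= (1 + expR k)^-1 by rewrite !ge_min lexx.
exists d; split; [by apply/andP; split; lra|by apply/andP; split; lra|].
rewrite -(expRK k) ler_ln ?posrE ?expR_gt0 ?divr_gt0//; last by lra.
rewrite ler_pdivlMr//.
have : d * (1 + expR k) <= 1 by rewrite -ler_pdivlMr// div1r.
lra.
Qed.

End log_barrier.

(** * Confinement in the funnel *)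

Section funnel.
Variables (R : realType) (n m : nat) (psi : formula R n) (rho_max : R).
Variables (f : 'cV[R]_n -> 'cV[R]_n) (g : 'cV[R]_n -> 'M[R]_(n, m)).
Notation rho := (robustR psi).
Hypothesis rho_diff : forall v, differentiable rho v.
Hypothesis rho_concave : forall v1 v2 (k : R), 0 <= k <= 1 ->
  k * rho v1 + (1 - k) * rho v2 <= rho (k *: v1 + (1 - k) *: v2).
Hypotheses (f_continuous : continuous f) (g_continuous : continuous g).
Hypothesis g_posdef : forall v, posdef (g v *m (g v)^T).
Variables (z : 'cV[R]_n) (gamma : R -> R) (L B : R).
Hypothesis rho_z : rho_max < rho z.
Hypothesis gamma_continuous : continuous gamma.
Hypothesis gamma_gt0 : forall t, 0 < gamma t.
Hypothesis gamma_noninc : forall s t, 0 <= s -> s <= t -> gamma t <= gamma s.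
Hypothesis gamma_lipschitz : forall s t, 0 <= s -> s <= t ->
  gamma s - gamma t <= L * (t - s).
Hypothesis L_ge0 : 0 <= L.
Hypothesis level_bounded : forall v, rho_max - gamma 0 <= rho v -> `|v| <= B.
Variables (W : set 'cV[R]_n) (w : R -> 'cV[R]_n).
Hypotheses (W_bounded : bounded_set W) (w_noise : noise W w).

Notation grad := (gradient rho).
Notation xi := (xi psi rho_max gamma).
Notation F := (closed_loop psi rho_max gamma f g w).

(** The direction of the feedback up to the factor [- epsilon]. Its pairing with the gradient is the
    quadratic form of [g v *m (g v)^T], so the sign of [epsilon] decides whether the robustness is
    pushed up or down. *)
Definition ascent (v : 'cV[R]_n) : 'cV[R]_n := g v *m ((g v)^T *m grad v).

(** The noise-free closed loop with the barrier value as a parameter [e], so that the true and the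
    clamped barrier share it. *)
Definition drift (v : 'cV[R]_n) (e : R) : 'cV[R]_n := f v - e *: ascent v.

Lemma closed_loopE v t : F v t = drift v (log_barrier (xi v t)) + w t.
Proof.
by rewrite /closed_loop /control -scalemxAr scaleNr.
Qed.

Let rho_continuous : continuous rho.
Proof. by move=> v; exact: (differentiable_continuous (rho_diff v)). Qed.

Let grad_continuous : continuous grad.
Proof. exact: gradient_continuous. Qed.

Lemma ascent_continuous : continuous ascent.
Proof.
move=> v; have gv := @g_continuous v.
exact: (cvg_mulmx gv (cvg_mulmx (cvg_trmx gv) (@grad_continuous v))).
Qed.

Lemma drift_cvg (T : Type) (G : set_system T) {FG : Filter G}
    (v : T -> 'cV[R]_n) (e : T -> R) v0 e0 :
  v t @[t --> G] --> v0 -> e t @[t --> G] --> e0 ->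
  drift (v t) (e t) @[t --> G] --> drift v0 e0.
Proof.
move=> vv ee; apply: cvgB; first exact: (cvg_comp _ f vv (@f_continuous v0)).
exact: (cvgZ ee (cvg_comp _ ascent vv (@ascent_continuous v0))).
Qed.

Lemma xi_cvg (T : Type) (G : set_system T) {FG : Filter G}
    (v : T -> 'cV[R]_n) (s : T -> R) v0 s0 :
  v t @[t --> G] --> v0 -> s t @[t --> G] --> s0 ->
  xi (v t) (s t) @[t --> G] --> xi v0 s0.
Proof.
move=> vv ss; apply: cvgM.
  apply: cvgB; last exact: cvg_cst.
  exact: (cvg_comp _ rho vv (@rho_continuous v0)).
apply: cvgV; first by rewrite gt_eqF.
exact: (cvg_comp _ gamma ss (@gamma_continuous s0)).
Qed.

(** A time-independent set containing the funnel at all nonnegative times, since [gamma] is largest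
    at 0. *)
Definition band : set 'cV[R]_n := [set v | rho_max - gamma 0 <= rho v <= rho_max].

Lemma xi_band v t : 0 <= t -> -1 <= xi v t <= 0 -> band v.
Proof.
move=> t0; rewrite /Defs.xi => /andP[]; rewrite ler_pdivlMr// ler_pdivrMr// => h1 h2.
by have := gamma_noninc (lexx 0) t0; rewrite /band /= => h3; apply/andP; split; lra.
Qed.

Lemma band_compact : compact band.
Proof.
apply: (@cV_bounded_closed_compact _ _ _ B).
  by move=> v /andP[+ _]; exact: level_bounded.
rewrite (_ : band = rho @^-1` `[rho_max - gamma 0, rho_max]).
  apply: preimage_closed; first by move=> v _; exact: rho_continuous.
  exact: interval_closed.
by apply/seteqP; split => v; rewrite /band /= in_itv.
Qed.

Lemma band_constants : exists c M N, [/\ 0 < c, 0 <= M, 0 <= N &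
  forall v, band v -> [/\ c <= dot (grad v) (ascent v),
    `|dot (grad v) (f v)| <= M &
    forall t, 0 <= t -> `|dot (grad v) (w t)| <= N]].
Proof.
have [C C0 gradC] := compact_fun_bounded band_compact grad_continuous.
have [D D0 fD] := compact_fun_bounded band_compact f_continuous.
have [b b0 wb] := noise_bounded W_bounded w_noise.
have gain_gt0 v : band v -> 0 < dot (grad v) (ascent v).
  move=> /andP[_ vmax]; rewrite /dot /ascent mulmxA mulmxA -[X in X *m _]mulmxA.
  apply: (g_posdef v).2; apply: (@gradient_neq0 _ _ _ rho_diff rho_concave v z).
  exact: le_lt_trans rho_z.
have [c c0 cP] : exists2 c, 0 < c &
    forall v, band v -> c <= dot (grad v) (ascent v).
  have [bE|/set0P bne] := eqVneq band set0.
    by exists 1 => // v; rewrite bE.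
  have gain_cont : continuous (fun v => dot (grad v) (ascent v)).
    by move=> v; exact: (cvg_dot (@grad_continuous v) (@ascent_continuous v)).
  have [v0 bv0 v0min] := compact_EVT_min bne band_compact
    (continuous_subspaceT gain_cont).
  exists (dot (grad v0) (ascent v0)); first exact/gain_gt0/set_mem.
  by move=> v bv; apply: v0min; exact/mem_set.
exists c, (n%:R * (C * D)), (n%:R * (C * b)); split => //.
- by rewrite !mulr_ge0// ltW.
- by rewrite !mulr_ge0// ltW.
move=> v bv; split; first exact: cP.
  by apply: dot_le; [exact: gradC|exact: fD].
by move=> t t0; apply: dot_le; [exact: gradC|exact: wb].
Qed.

(** * Invariance of the shrunken funnel *)

Section invariance.
Variables (c M N d : R).
Hypothesis c_gt0 : 0 < c.
Hypotheses (M_ge0 : 0 <= M) (N_ge0 : 0 <= N).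
Hypothesis band_bounds : forall v, band v -> [/\ c <= dot (grad v) (ascent v),
    `|dot (grad v) (f v)| <= M &
    forall t, 0 <= t -> `|dot (grad v) (w t)| <= N].
Hypothesis d01 : 0 < d < 1.
Hypothesis d_small : (M + N + L + 1) / c <= ln ((1 - d) / d).

Variables (G : 'cV[R]_n -> R -> 'cV[R]_n) (x0 : 'cV[R]_n) (x : R -> 'cV[R]_n).
Hypothesis G_eq : forall v t, 0 <= t -> - 1 + d < xi v t < - d -> G v t = F v t.
Hypothesis x0_inside : - 1 + d < xi x0 0 < - d.
Hypothesis x_solution : solution G x0 x.

Let y (t : R) : 'cV[R]_n := x (Num.max 0 t).

Let y_continuous : continuous y.
Proof. exact: solution_continuous x_solution. Qed.

Let yE t : 0 <= t -> y t = x t.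
Proof. by move=> t0; rewrite /y max_r. Qed.

Let x_0 : x 0 = x0.
Proof.
apply/matrixP => i j; rewrite ord1 (x_solution i (lexx 0)).2.
by rewrite set_itv1 Rintegral_set1 addr0.
Qed.

Let K := ln ((1 - d) / d).

(** At the ends of the shrunken funnel the feedback outweighs [f], the noise and the speed of the
    funnel with 1 to spare; half of this reserve is spent on the variation near the exit time. *)
Let K_large v : band v -> M + N + L + 1 <= K * dot (grad v) (ascent v).
Proof.
move=> /band_bounds[cv _ _].
have K0 : 0 <= K.
  by apply: le_trans d_small; rewrite divr_ge0 ?(ltW c_gt0)// !addr_ge0.
apply: le_trans (ler_wpM2l K0 cv).
by rewrite -ler_pdivrMr.
Qed.

(** The noise-free velocity is continuous along the trajectory, unlike the merely measurable noise:
    limits at the exit time are taken in [D], and the noise is only bounded by [N]. *)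
Let D (t : R) : 'cV[R]_n := drift (y t) (log_barrier (xi (y t) t)).

Let D_cvg t : -1 < xi (y t) t < 0 -> D s @[s --> t] --> D t.
Proof.
move=> yt; apply: drift_cvg; first exact: y_continuous.
apply: (cvg_comp (fun s => xi (y s) s) (@log_barrier R) _ (log_barrier_continuous yt)).
exact: (xi_cvg (@y_continuous t) cvg_id).
Qed.

Let step s T k p : 0 <= s -> s < T ->
  (forall r, s < r < T -> - 1 + d < xi (x r) r < - d) ->
  (forall r, s < r < T -> k <= dot p (D r) + dot p (w r)) ->
  k * (T - s) <= dot p (x T - x s).
Proof.
move=> s0 sT inside kD.
apply: (solution_increment x_solution s0 (ltW sT)) => r srT.
have r0 : 0 <= r by apply: le_trans s0 (ltW _); case/andP: srT.
rewrite G_eq//; last exact: inside.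
by rewrite closed_loopE dotDr -(yE r0); exact: kD.
Qed.

(* Concavity at the endpoint [x T] bounds the increment of the robustness from
   below by that of a linear function of [x], so that no chain rule along the
   (merely absolutely continuous) solution is needed. *)
Lemma no_lower_exit T : 0 < T ->
  (forall s, 0 <= s < T -> - 1 + d < xi (x s) s < - d) ->
  xi (x T) T <> - 1 + d.
Proof.
move=> T0 inside xT.
have T_ge0 := ltW T0.
have [d0 d1] := andP d01.
have bT : band (x T) by apply: (xi_band T_ge0); apply/andP; split; lra.
have [_ fM wN] := band_bounds bT.
have pD : dot (grad (x T)) (D t) @[t --> T] --> dot (grad (x T)) (D T).
  apply: (cvg_dot (cvg_cst _)); apply: D_cvg; rewrite yE//.
  by apply/andP; split; lra.
(* At the lower end the barrier equals [- K], so the feedback pushes the robustness up. *)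
have DT : M + N + L + 1 - M <= dot (grad (x T)) (D T).
  rewrite /D yE// xT log_barrier_lower// -/K /drift scaleNr opprK dotDr dotZr.
  have /ler_normlP[h1 h2] := fM; have := K_large bT; lra.
have near_D : \forall t \near T, N + L + 1 / 2 <= dot (grad (x T)) (D t).
  by apply: (cvgr_ge _ pD); lra.
move: near_D; rewrite -nbhs_nearE -nbhs_ballE => -[e /= e0 eD].
pose s := Num.max 0 (T - e / 2).
have s0 : 0 <= s by rewrite le_max lexx.
have se : T - e / 2 <= s by rewrite le_max lexx orbT.
have sT : s < T by rewrite gt_max T0/= gtrBl divr_gt0.
have : (L + 1 / 2) * (T - s) <= dot (grad (x T)) (x T - x s).
  apply: step => // r /andP[sr rT].
    by apply: inside; rewrite rT (le_trans s0 (ltW sr)).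
  have /ler_normlP[h1 h2] := wN r (le_trans s0 (ltW sr)).
  have := eD r _; rewrite /ball /= => /(_ _)/=.
  have -> : `|T - r| < e by apply/ltr_normlP; split; lra.
  by move=> /(_ erefl) h3; lra.
have := concave_le_gradient rho_diff rho_concave (x T) (x s).
rewrite -/(dot _ _) -[x s - x T]opprB dotNr => hc hi.
(* The robustness gains at least [(L + 1 / 2) * (T - s)], but the lower boundary, from above which
   it started, rises by at most [L * (T - s)]; so it cannot be on the boundary at [T]. *)
have /andP[xs _] : - 1 + d < xi (x s) s < - d by apply: inside; rewrite s0 sT.
move: xs xT; rewrite /Defs.xi ltr_pdivlMr// => xs.
move=> /(congr1 (fun u => u * gamma T)); rewrite divfK ?gt_eqF// => xT.
have gs := gamma_noninc s0 (ltW sT).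
have gl := gamma_lipschitz s0 (ltW sT).
have : (1 - d) * (gamma s - gamma T) <= gamma s - gamma T.
  by rewrite ler_piMl ?subr_ge0//; lra.
have : 0 < (T - s) by rewrite subr_gt0.
lra.
Qed.

(* As in [no_lower_exit], but an upper bound on the increment requires the
   gradient at the earlier endpoint [x s], which varies as [s] tends to [T]. *)
Lemma no_upper_exit T : 0 < T ->
  (forall s, 0 <= s < T -> - 1 + d < xi (x s) s < - d) ->
  xi (x T) T <> - d.
Proof.
move=> T0 inside xT.
have T_ge0 := ltW T0.
have [d0 d1] := andP d01.
have bT : band (x T) by apply: (xi_band T_ge0); apply/andP; split; lra.
have [_ fM _] := band_bounds bT.
have yT : -1 < xi (y T) T < 0 by rewrite yE//; apply/andP; split; lra.
(* The gradient is taken at [s] and the velocity at later times [r], hence a joint limit in two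
   independent times. *)
have pD : dot (grad (y p.1)) (D p.2) @[p --> ((T, T) : R * R)] -->
    dot (grad (y T)) (D T).
  apply: cvg_dot.
    have fstT : (fun p : R * R => p.1) p @[p --> ((T, T) : R * R)] --> T.
      exact: (@cvg_fst _ _ (nbhs T) (nbhs T)).
    apply: (cvg_comp _ (fun t => grad (y t)) fstT).
    exact: (cvg_comp _ grad (@y_continuous T) (@grad_continuous (y T))).
  have sndT : (fun p : R * R => p.2) p @[p --> ((T, T) : R * R)] --> T.
    exact: (@cvg_snd _ _ (nbhs T) (nbhs T)).
  exact: (cvg_comp _ D sndT (D_cvg yT)).
have DT : dot (grad (y T)) (D T) <= M - (M + N + L + 1).
  rewrite /D yE// xT log_barrier_upper// -/K /drift dotDr dotNr dotZr.
  have /ler_normlP[h1 h2] := fM; have := K_large bT; lra.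
have : \forall p \near ((T, T) : R * R), dot (grad (y p.1)) (D p.2) <= - N - 1 / 2.
  by apply: (cvgr_le _ pD); have := L_ge0; lra.
rewrite -nbhs_nearE -nbhs_ballE => -[e /= e0 eD].
pose s := Num.max 0 (T - e / 2).
have s0 : 0 <= s by rewrite le_max lexx.
have se : T - e / 2 <= s by rewrite le_max lexx orbT.
have sT : s < T by rewrite gt_max T0/= gtrBl divr_gt0.
have s_inside : - 1 + d < xi (x s) s < - d by apply: inside; rewrite s0 sT.
have bs : band (x s).
  by apply: (xi_band s0); case/andP: s_inside => ? ?; apply/andP; split; lra.
have [_ _ wN] := band_bounds bs.
have : 1 / 2 * (T - s) <= dot (- grad (x s)) (x T - x s).
  apply: step => // r /andP[sr rT].
    by apply: inside; rewrite rT (le_trans s0 (ltW sr)).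
  have /ler_normlP[h1 h2] := wN r (le_trans s0 (ltW sr)).
  have : dot (grad (y s)) (D r) <= - N - 1 / 2.
    by apply: (eD (s, r)); split; rewrite /ball/=; apply/ltr_normlP; split; lra.
  by rewrite yE// !dotNl => h3; lra.
have := concave_le_gradient rho_diff rho_concave (x s) (x T).
rewrite -/(dot _ _) dotNl => hc hi.
(* The robustness has dropped between [s] and [T], whereas the upper boundary [rho_max - d * gamma]
   does not fall, so the boundary cannot have been reached from below. *)
have /andP[_ xs] := s_inside.
move: xs xT; rewrite /Defs.xi ltr_pdivrMr// => xs.
move=> /(congr1 (fun u => u * gamma T)); rewrite divfK ?gt_eqF// => xT.
have gs := gamma_noninc s0 (ltW sT).
have : d * gamma T <= d * gamma s by rewrite ler_pM2l.
have : 0 < (T - s) by rewrite subr_gt0.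
lra.
Qed.

(** At a first exit one of the two boundaries would be reached. [G] agrees with the closed loop only
    inside the funnel, so the result covers both the closed loop and its truncation. *)
Lemma funnel_invariant t : 0 <= t -> - 1 + d < xi (x t) t < - d.
Proof.
move=> t0; apply: contrapT => nt.
have q_continuous : continuous (fun t => xi (y t) t).
  by move=> s; exact: (xi_cvg (@y_continuous s) cvg_id).
have q0 : - 1 + d < xi (y 0) 0 < - d by rewrite yE// x_0.
have qt : ~ (- 1 + d < xi (y t) t < - d) by rewrite yE.
have [T [T0 inside exit]] := first_exit q_continuous q0 t0 qt.
have inside' s : 0 <= s < T -> - 1 + d < xi (x s) s < - d.
  by move=> sT; rewrite -yE; [exact: inside|case/andP: sT].
move: exit; rewrite yE ?ltW// => -[].
  exact: no_lower_exit.
exact: no_upper_exit.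
Qed.

End invariance.

(** * Truncation of the feedback *)

Section truncation.
Variable d : R.
Hypothesis d01 : 0 < d < 1.

Definition clamp (s : R) : R := Num.max (- 1 + d) (Num.min s (- d)).

(** Equal to 1 on the ball of radius [B], which contains the band, and to 0 beyond radius
    [B + 1]. *)
Definition cutoff (v : 'cV[R]_n) : R := Num.max 0 (Num.min (B + 1 - `|v|) 1).

(* A bounded, globally continuous field that agrees with the noise-free closed
   loop inside the shrunken funnel, where its solutions are then shown to stay. *)
Definition truncated (v : 'cV[R]_n) (t : R) : 'cV[R]_n :=
  cutoff v *: drift v (log_barrier (clamp (xi v t))).

Let clamp_itv s : -1 < clamp s < 0.
Proof.
have /andP[d0 d1] := d01; rewrite /clamp lt_max gt_max gt_min.
by apply/andP; split; [apply/orP; left|apply/andP; split; [|apply/orP; right]]; lra.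
Qed.

Let clamp_id s : - 1 + d < s < - d -> clamp s = s.
Proof. by move=> /andP[s1 s2]; rewrite /clamp min_l ?max_r// ltW. Qed.

Let log_barrier_clamp_continuous : continuous (fun s => log_barrier (clamp s)).
Proof.
move=> s; apply: (cvg_comp clamp (@log_barrier R) _
  (log_barrier_continuous (clamp_itv s))).
apply: (@continuous_max _ _ (cst (- 1 + d)) (fun s => Num.min s (- d))).
  exact: cvg_cst.
apply: (@continuous_min _ _ id (cst (- d))); first exact: cvg_id.
exact: cvg_cst.
Qed.

Let log_barrier_clamp_bounded :
  exists2 b : R, 0 < b & forall s, `|log_barrier (clamp s)| <= b.
Proof.
have /andP[d0 d1] := d01.
have [b b0 bP] := compact_fun_bounded (@segment_compact _ (-1) 0)
  log_barrier_clamp_continuous.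
(* [clamp] is constant on each side of [[-1, 0]], so a bound on this compact interval suffices. *)
exists b => // s; have [s1|s1] := ltP s (-1).
  rewrite (_ : clamp s = clamp (-1)); last first.
    by rewrite /clamp !max_l// ge_min; apply/orP; left; lra.
  by apply: bP; rewrite /= in_itv/= lexx lerN10.
have [s0|s0] := ltP 0 s.
  rewrite (_ : clamp s = clamp 0); last by rewrite /clamp !min_r//; lra.
  by apply: bP; rewrite /= in_itv/= lexx lerN10.
by apply: bP; rewrite /= in_itv/= s1.
Qed.

Let cutoff_continuous : continuous cutoff.
Proof.
pose h (r : R) : R := Num.max 0 (Num.min (B + 1 - r) 1).
have h_continuous : continuous h.
  move=> r; apply: (@continuous_max _ _ (cst 0) (fun r => Num.min (B + 1 - r) 1)).
    exact: cvg_cst.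
  apply: (@continuous_min _ _ (fun r => B + 1 - r) (cst 1)); last exact: cvg_cst.
  exact: (cvgB (cvg_cst _) cvg_id).
move=> v.
exact: (cvg_comp (@Num.norm _ 'cV[R]_n) h (@norm_continuous _ _ v) (@h_continuous `|v|)).
Qed.

Lemma truncated_cvg y t :
  truncated p.1 p.2 @[p --> ((y, t) : 'cV[R]_n * R)] --> truncated y t.
Proof.
have cvg1 : (fun p : 'cV[R]_n * R => p.1) p @[p --> ((y, t) : 'cV[R]_n * R)] --> y.
  exact: (@cvg_fst _ _ (nbhs y) (nbhs t)).
have cvg2 : (fun p : 'cV[R]_n * R => p.2) p @[p --> ((y, t) : 'cV[R]_n * R)] --> t.
  exact: (@cvg_snd _ _ (nbhs y) (nbhs t)).
apply: cvgZ; first exact: (cvg_comp _ cutoff cvg1 (@cutoff_continuous y)).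
apply: (drift_cvg cvg1).
exact: (cvg_comp _ (fun s => log_barrier (clamp s)) (xi_cvg cvg1 cvg2)
  (@log_barrier_clamp_continuous (xi y t))).
Qed.

Lemma truncated_bounded : exists C, forall v t, `|truncated v t| <= C.
Proof.
have cB : compact [set v : 'cV[R]_n | `|v| <= B + 1].
  apply: (@cV_bounded_closed_compact _ _ _ (B + 1)) => //.
  apply: (@preimage_closed _ _ (@Num.norm _ 'cV[R]_n) [set s : R | s <= B + 1]).
    by move=> v _; exact: norm_continuous.
  exact: closed_le.
have [Cf Cf0 fP] := compact_fun_bounded cB f_continuous.
have [Ca Ca0 aP] := compact_fun_bounded cB ascent_continuous.
have [b b0 bP] := log_barrier_clamp_bounded.
have C0 : 0 <= Cf + b * Ca by rewrite addr_ge0 ?mulr_ge0 ?ltW.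
exists (Cf + b * Ca) => v t.
have [vB|vB] := leP `|v| (B + 1); last first.
  rewrite /truncated (_ : cutoff v = 0) ?scale0r ?normr0//.
  by rewrite /cutoff max_l// ge_min; apply/orP; left; lra.
have cut0 : 0 <= cutoff v by rewrite le_max lexx.
have cut1 : cutoff v <= 1 by rewrite ge_max ge_min lexx ler01 orbT.
rewrite /truncated normrZ ger0_norm//.
apply: le_trans (ler_piMl _ cut1) _ => //.
apply: le_trans (ler_normB _ _) _; rewrite lerD ?fP// normrZ.
by rewrite ler_pM ?bP ?aP.
Qed.

Lemma truncated_eq v t : 0 <= t -> - 1 + d < xi v t < - d ->
  truncated v t + w t = F v t.
Proof.
move=> t0 vt; rewrite closed_loopE /truncated clamp_id//.
rewrite (_ : cutoff v = 1) ?scale1r//.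
have /andP[d0 d1] := d01.
have /andP[/level_bounded vB _] : band v.
  by apply: (xi_band t0); case/andP: vt => ? ?; apply/andP; split; lra.
by rewrite /cutoff min_r ?max_r//; lra.
Qed.

End truncation.

Lemma funnel_solutions x0 : -1 < xi x0 0 < 0 -> exists d, [/\ 0 < d < 1,
  exists x, solution F x0 x &
  forall x, solution F x0 x -> forall t, 0 <= t -> - 1 + d < xi (x t) t < - d].
Proof.
move=> x0_itv.
have [c [M [N [c0 M0 N0 cMN]]]] := band_constants.
have k0 : 0 < (M + N + L + 1) / c by rewrite divr_gt0// ltr_wpDl// !addr_ge0.
have [d [d01 x0d dk]] := log_barrier_margin k0 x0_itv.
have inv G x := @funnel_invariant _ _ _ _ c0 M0 N0 cMN d01 dk G x0 x.
exists d; split => //; last first.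
  by move=> x; apply: inv.
have [C CP] := truncated_bounded d01.
have [x xs] := solution_exists W_bounded w_noise x0 (truncated_cvg d01) CP.
(* Invariance for the truncated field confines its solution to the region where both fields agree,
   so this solution also solves the closed loop. *)
have x_in := inv _ x (@truncated_eq d d01) x0d xs.
have xE (t : R) s : `[0, t]%classic s -> truncated d (x s) s + w s = F (x s) s.
  by rewrite /= in_itv/= => /andP[s0 _]; rewrite truncated_eq// x_in.
exists x => t i t0; have [int_x ->] := xs t i t0; split.
  apply: eq_integrable int_x => // s; rewrite inE => st.
  by rewrite /= (xE t).
by congr (_ + _); apply: eq_Rintegral => s; rewrite inE => st; rewrite (xE t).
Qed.

End funnel.

(** * Robustness and the main result *)

(** The shape of the formula alone decides: the value is infinite for conjunctions of [Top] only,
    and a single predicate makes it finite everywhere. *)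
Lemma robust_fin_or_top (R : realType) (n : nat) (psi : formula R n) :
  (forall v, robust psi v = +oo%E) \/ (forall v, robust psi v \is a fin_num).
Proof.
elim: psi => [|h|h|psi1 IH1 psi2 IH2] /=; [by left|by right|by right|].
have fin_and (a b : \bar R) : a = +oo%E \/ a \is a fin_num -> b \is a fin_num ->
    (- lne (expeR (- a) + expeR (- b)))%E \is a fin_num.
  case: b => // b [->|].
    rewrite -[expeR (- +oo)]/0%E add0e -[expeR _]/(expR (- b))%:E.
    by rewrite lne_EFin ?expR_gt0.
  case: a => // a _.
  rewrite -[expeR (- a%:E)]/(expR (- a))%:E -[expeR _]/(expR (- b))%:E -EFinD.
  by rewrite lne_EFin// addr_gt0 ?expR_gt0.
case: IH1 IH2 => [t1|f1] [t2|f2].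
- by left => v; rewrite t1 t2 /= addr0 lexx.
- by right => v; apply: fin_and => //; left.
- by right => v; rewrite addeC; apply: fin_and => //; left.
- by right => v; apply: fin_and => //; right.
Qed.

(** If the smooth conjunction is positive, the two exponentials sum to less than 1, so each is below
    1 and both conjuncts are positive. Strict positivity matters for negated predicates. *)
Lemma robust_gt0_holds (R : realType) (n : nat) (psi : formula R n) v :
  (0 < robust psi v)%E -> holds psi v.
Proof.
elim: psi => [//|h|h|psi1 IH1 psi2 IH2] /=.
- by rewrite lte_fin => /ltW.
- by rewrite lte_fin oppr_gt0 ltNge => /negP.
rewrite oppe_gt0 lne_lt0 => lt1.
have pos (a b : \bar R) : (expeR (- a) + expeR (- b) < 1 -> 0 < a)%E.
  move=> ab; rewrite -oppe_lt0 -lte_expeR expeR0.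
  by apply: le_lt_trans ab; rewrite leeDl// expeR_ge0.
by split; [apply/IH1/(pos _ _ lt1)|apply/IH2; apply: (pos _ (robust psi1 v)); rewrite addeC].
Qed.

(** * The exponential funnel *)

Section funnel_function.
Variables (R : realType) (gamma0 gamma_inf l : R).
Hypotheses (gamma_inf_gt0 : 0 < gamma_inf) (gamma_le : gamma_inf <= gamma0).
Hypothesis l_ge0 : 0 <= l.
Notation gamma := (funnel gamma0 gamma_inf l).

Lemma funnel_ge t : gamma_inf <= gamma t.
Proof. by rewrite /funnel lerDr mulr_ge0 ?expR_ge0// subr_ge0. Qed.

Lemma funnel_gt0 t : 0 < gamma t.
Proof. exact: lt_le_trans (funnel_ge t). Qed.

Lemma funnel_0 : gamma 0 = gamma0.
Proof. by rewrite /funnel mulr0 expR0 mulr1 subrK. Qed.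

Lemma funnel_noninc s t : s <= t -> gamma t <= gamma s.
Proof.
move=> st; rewrite /funnel lerD2r ler_wpM2l ?subr_ge0// ler_expR.
by rewrite !mulNr lerN2 ler_wpM2l.
Qed.

(** Follows from [1 - expR (- u) <= u] with [u = l * (t - s)], and [expR (- l * s) <= 1]. *)
Lemma funnel_lipschitz s t : 0 <= s -> s <= t ->
  gamma s - gamma t <= (gamma0 - gamma_inf) * l * (t - s).
Proof.
move=> s0 st.
rewrite /funnel opprD addrACA subrr addr0 -mulrBr -mulrA ler_wpM2l ?subr_ge0//.
rewrite (_ : - l * t = - l * s + - (l * (t - s))); last by ring.
rewrite expRD -{1}[expR _]mulr1 -mulrBr.
have h1 : 1 - expR (- (l * (t - s))) <= l * (t - s).
  by have := expR_ge1Dx (- (l * (t - s))); lra.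
have h2 : 0 <= 1 - expR (- (l * (t - s))).
  by rewrite subr_ge0 -expR0 ler_expR oppr_le0 mulr_ge0// subr_ge0.
apply: le_trans h1; rewrite ler_piMl// -expR0 ler_expR mulNr oppr_le0.
exact: mulr_ge0.
Qed.

Lemma funnel_continuous : continuous gamma.
Proof.
move=> t; apply: cvgD; last exact: cvg_cst.
apply: cvgM; first exact: cvg_cst.
apply: (cvg_comp (fun t => - l * t) (@expR R) _ (@continuous_expR R _)).
by apply: cvgM; [exact: cvg_cst|exact: cvg_id].
Qed.

End funnel_function.

Theorem theorem2 (R : realType) (n m : nat)
  (f : 'cV[R]_n -> 'cV[R]_n) (g : 'cV[R]_n -> 'M[R]_(n, m))
  (W : set 'cV[R]_n) (hW : bounded_set W)
  (x0 : 'cV[R]_n)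
  (a b : \bar R) (ha : (0 <= a)%E) (hab : (a <= b)%E)
  (psi : formula R n) (phi : temporal R n)
  (hphi : phi = Always a b psi \/ phi = Eventually a b psi)
  (hf : [locally [lipschitz f v | v in [set: 'cV[R]_n]]])
  (hg : [locally [lipschitz g v | v in [set: 'cV[R]_n]]])
  (hgg : forall v, posdef (g v *m (g v)^T))
  (hdiff : forall v, differentiable (robustR psi) v)
  (hconc : concave_robust psi)
  (hwp : well_posed psi)
  (hopt : (0 < robust_opt psi)%E)
  (rho_max : R)
  (hmax1 : (Order.max 0 (robust psi x0) < rho_max%:E)%E)
  (hmax2 : (rho_max%:E < robust_opt psi)%E)
  (r : R) (hr : 0 <= r < rho_max)
  (ts : R) (hts0 : 0 <= ts) (hts : admissible_time phi ts)
  (hfeas : feasible psi r x0 ts)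
  (gamma0 gamma_inf l : R)
  (hgamma0 : (rho_max%:E - robust psi x0 < gamma0%:E)%E)
  (hgamma0' : ts = 0 -> gamma0 <= rho_max - r)
  (hgamma_inf : 0 < gamma_inf <= Order.min gamma0 (rho_max - r))
  (hl1 : r <= - gamma0 + rho_max -> 0 <= l)
  (hl2 : - gamma0 + rho_max < r -> 0 < ts ->
    0 < (r + gamma_inf - rho_max) / - (gamma0 - gamma_inf) /\
    l = - (1 / ts) * ln ((r + gamma_inf - rho_max) / - (gamma0 - gamma_inf)))
  (w : R -> 'cV[R]_n) (hw : noise W w) :
  let gamma := funnel gamma0 gamma_inf l in
  let F := closed_loop psi rho_max gamma f g w in
  (exists x : R -> 'cV[R]_n,
     solution F x0 x /\ forall t, 0 <= t -> -1 < xi psi rho_max gamma (x t) t < 0) /\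
  (forall x : R -> 'cV[R]_n, solution F x0 x ->
     0 <= r /\ (r%:E < robust_temporal phi x 0)%E /\
     (robust_temporal phi x 0 < rho_max%:E)%E /\ sat x 0 phi).
Proof.
move=> gamma F.
have /andP[gi0] := hgamma_inf; rewrite le_min => /andP[gi_le gi_r].
have /andP[r0 r_max] := hr.
have [hmax0 hmaxx0] : (0 < rho_max%:E)%E /\ (robust psi x0 < rho_max%:E)%E.
  by move: hmax1; rewrite gt_max => /andP[].
have [psi_top|psi_fin] := robust_fin_or_top psi.
  by move: hmaxx0; rewrite psi_top.
pose rho := robustR psi.
have rhoE v : robust psi v = (rho v)%:E by rewrite fineK.
have rho_concave v1 v2 (k : R) : 0 <= k <= 1 ->
    k * rho v1 + (1 - k) * rho v2 <= rho (k *: v1 + (1 - k) *: v2).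
  by move=> /(hconc v1 v2); rewrite !rhoE -!EFinM -EFinD lee_fin.
have [z rho_z] : exists z, rho_max < rho z.
  have [_ [z _ <-]] := ereal_sup_gt hmax2.
  by rewrite rhoE lte_fin; exists z.
have rmax0 : 0 < rho_max by rewrite -lte_fin.
have rho_x0 : rho x0 < rho_max by rewrite -lte_fin -rhoE.
have gamma_x0 : rho_max - rho x0 < gamma0 by rewrite -lte_fin EFinB -rhoE.
have [C holdsC] := hwp.
have [B levelB] : exists B, forall v, rho_max - gamma 0 <= rho v -> `|v| <= B.
  apply: (@superlevel_bounded R n rho rho_concave C _ z _ (lt_trans rmax0 rho_z)).
  move=> v v0; apply: (holdsC (fun=> v)).
  by apply: robust_gt0_holds; rewrite rhoE lte_fin.
(* From time [ts] on, the lower boundary [rho_max - gamma] is at least [r]: either this holds from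
   time 0, or [l] is tuned to give equality at [ts]. *)
have [l0 gamma_ts] : 0 <= l /\ gamma ts <= rho_max - r.
  have [case1|case2] := leP r (- gamma0 + rho_max).
    have l0 := hl1 case1; split => //.
    apply: le_trans (funnel_noninc gi_le l0 hts0) _.
    by rewrite funnel_0; lra.
  have ts0 : 0 < ts.
    rewrite lt_neqAle hts0 andbT eq_sym; apply/eqP => /hgamma0'; lra.
  (* The quotient is the required value of [expR (- l * ts)]; its positivity excludes
     [gamma_inf = rho_max - r], for which no finite [l] would do. *)
  have [q0 lE] := hl2 case2 ts0.
  set q := _ / - _ in q0 lE.
  have qE : q * (gamma0 - gamma_inf) = rho_max - r - gamma_inf.
    rewrite -[gamma0 - gamma_inf]opprK mulrN /q divfK; first by ring.
    by rewrite oppr_eq0 gt_eqF//; lra.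
  have q1 : q <= 1 by rewrite -(ler_pM2r (_ : 0 < gamma0 - gamma_inf)); lra.
  split.
    by rewrite lE mulNr oppr_ge0 mulr_ge0_le0 ?ln_le0// divr_ge0.
  rewrite /gamma /funnel (_ : - l * ts = ln q).
    by rewrite lnK ?posrE// mulrC qE; lra.
  by rewrite lE; field; rewrite gt_eqF.
have gamma_gt0 : forall t, 0 < gamma t by exact: funnel_gt0.
have gammaL := funnel_lipschitz gi_le l0.
have L0 : 0 <= (gamma0 - gamma_inf) * l by rewrite mulr_ge0// subr_ge0.
have xi0 : -1 < xi psi rho_max gamma x0 0 < 0.
  rewrite /xi ltr_pdivlMr// ltr_pdivrMr// /gamma funnel_0.
  by apply/andP; split; rewrite -/(rho x0); lra.
have [d [/andP[d0 d1] ex_sol sol_in]] := @funnel_solutions R n m psi rho_max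
  f g hdiff rho_concave (locally_lipschitz_continuous hf)
  (locally_lipschitz_continuous hg) hgg z gamma ((gamma0 - gamma_inf) * l) B
  rho_z (@funnel_continuous R gamma0 gamma_inf l) gamma_gt0
  (fun s t _ st => funnel_noninc gi_le l0 st) gammaL
  L0 levelB W w hW hw x0 xi0.
split.
  have [x xs] := ex_sol; exists x; split => // t t0.
  by have /andP[h1 h2] := sol_in x xs t t0; apply/andP; split; lra.
move=> x xs.
have rho_lt t : 0 <= t -> rho (x t) <= rho_max - d * gamma_inf.
  move=> t0; have /andP[_] := sol_in x xs t t0.
  rewrite /xi ltr_pdivrMr// -/(rho (x t)) => h.
  have : d * gamma_inf <= d * gamma t by rewrite ler_pM2l// funnel_ge.
  lra.
(* The bound is [rho_max - (1 - d) * (rho_max - r)], a margin above [r] uniform in time. *)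
have rho_gt t : ts <= t -> r + d * (rho_max - r) <= rho (x t).
  move=> tst; have /andP[+ _] := sol_in x xs t (le_trans hts0 tst).
  rewrite /xi ltr_pdivlMr// -/(rho (x t)) => h.
  have : (1 - d) * gamma t <= (1 - d) * (rho_max - r).
    rewrite ler_pM2l ?subr_gt0//; apply: le_trans gamma_ts.
    exact: funnel_noninc.
  lra.
have dr0 : 0 < d * (rho_max - r) by rewrite mulr_gt0// subr_gt0.
have dg0 : 0 < d * gamma_inf by rewrite mulr_gt0.
have rho_sat t : ts <= t -> holds psi (x t).
  move=> tst; apply: robust_gt0_holds; rewrite rhoE lte_fin.
  by have := rho_gt t tst; lra.
split => //; case: hphi hts => -> /=.
  (* Here [ts = a], so the whole window lies after [ts]; it contains [ts], which bounds the infimum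
     from above. *)
  move=> aE; have win s : window 0 a b s -> ts <= s.
    by rewrite /window /= -aE add0e lee_fin => -[].
  have win_ts : window 0 a b ts by rewrite /window /= -aE !add0e lexx aE.
  split; last split.
  - apply: (@lt_le_trans _ _ (r + d * (rho_max - r))%:E).
      by rewrite lte_fin ltrDl.
    apply: le_ereal_inf_tmp => _ [s /win tss <-].
    by rewrite rhoE lee_fin rho_gt.
  - apply: (@le_lt_trans _ _ (robust psi (x ts))).
      by apply: ereal_inf_lbound; exists ts.
    by rewrite rhoE lte_fin; have := rho_lt ts hts0; lra.
  - by move=> s /win; exact: rho_sat.
(* The time [ts] alone is the witness and bounds the supremum from below; the upper bound needs the
   uniform margin over the whole window. *)
move=> [ats tsb]; have win_ts : window 0 a b ts by rewrite /window /= !add0e.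
have win s : window 0 a b s -> 0 <= s.
  by rewrite /window /= add0e => -[sa _]; rewrite -lee_fin (le_trans ha).
split; last split.
- apply: (@lt_le_trans _ _ (robust psi (x ts))).
    by rewrite rhoE lte_fin; have := rho_gt ts (lexx _); lra.
  by apply: ereal_sup_ubound; exists ts.
- apply: (@le_lt_trans _ _ (rho_max - d * gamma_inf)%:E); last first.
    by rewrite lte_fin gtrBl.
  apply: ge_ereal_sup => _ [s /win s0 <-].
  by rewrite rhoE lee_fin rho_lt.
- by exists ts => //; exact: rho_sat.
Qed.
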